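(* Let $G$ be a finite group, and let $U$ and $U'$ be projective unitary representations of $G$ on the input and output multipartite (i.e. $m$-party, finite-dimensional) Hilbert spaces $\mathcal{H}=\bigotimes_{i=1}^m\mathcal{H}_{A_i}$ and $\mathcal{H}'=\bigotimes_{i=1}^m\mathcal{H}_{B_i}$, respectively. Suppose that $U(g)$ and $U'(g)$ are tensor products of local unitaries for every $g\in G$. Then, for arbitrary multipartite states $\rho$ on $\mathcal{H}$ and $\sigma$ on $\mathcal{H}'$, $$R_{G\text{-}\mathrm{cov},\mathrm{LOCC}}(\rho\to\sigma)=\begin{cases}R_{\mathrm{LOCC}}(\rho\to\sigma)&\text{if }\mathrm{Sym}_{G,U}(\rho)\subset\mathrm{Sym}_{G,U'}(\sigma),\\0&\text{otherwise.}\end{cases}$$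
   Context: $\mathrm{Sym}_{G,U}(\rho):=\{g\in G\mid U(g)\rho U(g)^\dagger=\rho\}$, similarly for $\sigma$ and $U'$. LOCC denotes the channels implementable by (finite-round) local operations and classical communication among the $m$ parties; on $n$ copies, party $i$ holds $\mathcal{H}_{A_i}^{\otimes n}$, and the representation is $U(g)^{\otimes n}$ (similarly for the output). A channel $\mathcal{E}$ from $n$ copies of the input to $k$ copies of the output is $G$-covariant if $\mathcal{E}(U(g)^{\otimes n}LU(g)^{\dagger\otimes n})=U'(g)^{\otimes k}\mathcal{E}(L)U'(g)^{\dagger\otimes k}$ for all $g\in G$ and all $L$. For a class $\mathcal{O}$ of channels, $R_{\mathcal{O}}(\rho\to\sigma)$ is the supremum of all $r\ge0$ for which there are $\mathcal{E}^{(n)}\in\mathcal{O}$ from $n$ input copies to $\lfloor rn\rfloor$ output copies with $\frac12\|\mathcal{E}^{(n)}(\rho^{\otimes n})-\sigma^{\otimes\lfloor rn\rfloor}\|_1\to0$ as $n\to\infty$. $R_{\mathrm{LOCC}}$ uses all LOCC channels; $R_{G\text{-}\mathrm{cov},\mathrm{LOCC}}$ uses the LOCC channels that are $G$-covariant (only the overall channel is required to be covariant). *)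

(* Defs.v *)
From HB Require Import structures.
From mathcomp Require Export all_boot all_order all_algebra all_fingroup.
From mathcomp Require Export complex.
From mathcomp Require Export boolp classical_sets reals ereal topology normedtype
  sequences.

Set Implicit Arguments.
Unset Strict Implicit.
Unset Printing Implicit Defensive.

Import Order.TTheory GRing.Theory Num.Theory.
Import numFieldNormedType.Exports.

Local Open Scope sesquilinear_scope.
Local Open Scope complex_scope.
Local Open Scope ring_scope.

(* Operators on the Hilbert space C^T whose orthonormal basis is labelled by the
   finite type T.  Matrix indices are the ranks of the labels. *)
Notation op R T := 'M[R[i]]_#|(T : finType)|.

Section Operators.
Variable R : realType.

Definition ent (S T : finType) (X : 'M[R[i]]_(#|S|, #|T|)) (x : S) (y : T) : R[i] :=
  X (enum_rank x) (enum_rank y).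

Definition mkop (T : finType) (f : T -> T -> R[i]) : op R T :=
  \matrix_(i, j) f (enum_val i) (enum_val j).

Definition ketbra (T : finType) (x y : T) : op R T :=
  delta_mx (enum_rank x) (enum_rank y).

(* On R[i], 0 <= z means that z is real and nonnegative, so Hermiticity of X
   follows. *)
Definition psd n (X : 'M[R[i]]_n) : Prop :=
  forall v : 'cV[R[i]]_n, 0 <= (v^t* *m X *m v) 0 0.

Definition density n (X : 'M[R[i]]_n) : Prop := psd X /\ \tr X = 1.

(* Square root of a positive semidefinite matrix by functional calculus;
   spectralmx diagonalizes normal matrices only. *)
Definition sqrtmx n (X : 'M[R[i]]_n) : 'M[R[i]]_n :=
  invmx (spectralmx X) *m diag_mx (map_mx sqrtC (spectral_diag X))
    *m spectralmx X.

Definition trnorm n (X : 'M[R[i]]_n) : R :=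
  complex.Re (\tr (sqrtmx (X^t* *m X))).

Definition trdist n (X Y : 'M[R[i]]_n) : R := 2^-1 * trnorm (X - Y).

(* id_K (x) F, where F is applied to the blocks of X. *)
Definition ampliation (K S T : finType) (F : op R S -> op R T)
    (X : op R (K * S)%type) : op R (K * T)%type :=
  mkop (fun p q : K * T =>
    ent (F (mkop (fun x y => ent X (p.1, x) (q.1, y)))) p.2 q.2).

Definition completely_positive (S T : finType) (F : op R S -> op R T) : Prop :=
  linear F /\
  forall (K : finType) (X : op R (K * S)%type), psd X -> psd (ampliation F X).

Definition trace_preserving (S T : finType) (F : op R S -> op R T) : Prop :=
  forall X, \tr (F X) = \tr X.

Definition proj_unitary_rep (G : finGroupType) n (U : G -> 'M[R[i]]_n) : Prop :=
  (forall g, U g \is unitarymx) /\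
  (forall g h, exists2 w : R[i], `|w| = 1 & U g *m U h = w *: U (g * h)%g).

Definition Sym (G : finGroupType) n (U : G -> 'M[R[i]]_n) (rho : 'M[R[i]]_n) :
    {set G} :=
  [set g | U g *m rho *m (U g)^t* == rho].

End Operators.

(* Basis labels of the m-party space with local basis labels A i. *)
Notation joint A := {dffun forall i, A i}.

Section Multipartite.
Variables (R : realType) (m : nat).
Implicit Types A B S T : 'I_m -> finType.

Definition tensor A (X : forall i, op R (A i)) : op R (joint A) :=
  mkop (fun x y : joint A => \prod_i ent (X i) (x i) (y i)).

(* The product map (x)_i F i, determined by linearity from its values on the
   product matrix units |x><y|. *)
Definition tensor_map S T (F : forall i, op R (S i) -> op R (T i))
    (X : op R (joint S)) : op R (joint T) :=
  \sum_(x : joint S) \sum_(y : joint S)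
    ent X x y *: tensor (fun i => F i (ketbra R (x i) (y i))).

Definition local_unitary A (X : op R (joint A)) : Prop :=
  exists u : forall i, op R (A i),
    (forall i, u i \is unitarymx) /\ X = tensor u.

(* With n copies, party i holds the n-fold tensor power of its space. *)
Definition copies n A : 'I_m -> finType := fun i => {ffun 'I_n -> A i}.

Definition copy n A (x : joint (copies n A)) (l : 'I_n) : joint A :=
  [ffun i => x i l].

(* X^(x)n, with the tensor factors grouped by party. *)
Definition power n A (X : op R (joint A)) : op R (joint (copies n A)) :=
  mkop (fun x y => \prod_(l < n) ent X (copy x l) (copy y l)).

(* Channels of finite-round protocols.  In a round, party k applies an
   instrument and broadcasts its outcome j, after which the other parties apply
   local channels depending on j.  The rest of the protocol, the local output
   spaces included, may depend on all earlier outcomes. *)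
Inductive locc : forall S T, (op R (joint S) -> op R (joint T)) -> Prop :=
| locc_id S (L : op R (joint S) -> op R (joint S)) :
    (forall X, L X = X) -> locc L
| locc_round S T (L : op R (joint S) -> op R (joint T))
    (k : 'I_m) (J : finType) (W : J -> 'I_m -> finType)
    (F : forall j i, op R (S i) -> op R (W j i))
    (E : forall j, op R (joint (W j)) -> op R (joint T)) :
    (forall j i, completely_positive (F j i)) ->
    (forall X, \sum_j \tr (F j k X) = \tr X) ->
    (forall j i, i != k -> trace_preserving (F j i)) ->
    (forall j, locc (E j)) ->
    (forall X, L X = \sum_j E j (tensor_map (F j) X)) ->
    locc L.

Section Rates.
Variables A B : 'I_m -> finType.

Definition channel_class :=
  forall n k : nat, (op R (joint (copies n A)) -> op R (joint (copies k B))) -> Prop.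

Definition LOCC : channel_class := fun n k E => locc E.

Definition covariant (G : finGroupType) (U : G -> op R (joint A))
    (U' : G -> op R (joint B)) n k
    (E : op R (joint (copies n A)) -> op R (joint (copies k B))) : Prop :=
  forall (g : G) (L : op R (joint (copies n A))),
    E (power n (U g) *m L *m (power n (U g))^t*) =
    power k (U' g) *m E L *m (power k (U' g))^t*.

Definition cov_LOCC (G : finGroupType) (U : G -> op R (joint A))
    (U' : G -> op R (joint B)) : channel_class :=
  fun n k E => LOCC E /\ covariant U U' E.

(* truncn is the floor on nonnegative reals. *)
Definition achievable (O : channel_class) (rho : op R (joint A))
    (sigma : op R (joint B)) (r : R) : Prop :=
  let k n := Num.truncn (r * n%:R) in
  exists E : forall n : nat,
      op R (joint (copies n A)) -> op R (joint (copies (k n) B)),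
    (forall n, O n (k n) (E n)) /\
    ((fun n : nat => trdist (E n (power n rho)) (power (k n) sigma)) @ \oo
       --> (0 : R))%classic.

Definition rate (O : channel_class) (rho : op R (joint A))
    (sigma : op R (joint B)) : \bar R :=
  ereal_sup [set r%:E | r in
    [set r : R | 0 <= r /\ achievable O rho sigma r]]%classic.

End Rates.
End Multipartite.

(* Main.v *)
(* If a covariant protocol has positive rate and g fixes rho, then its output is
   fixed by U'(g), so sigma^k and its image under U'(g) become indistinguishable;
   discarding all but one copy shows that g fixes sigma.

   Conversely, let Sym(rho) be contained in Sym(sigma) and let E^(n) achieve the
   rate r.  For q < r, use n' ~ (q/r) n copies as input of E^(n') and measure the
   other s ~ (1 - q/r) n copies one by one with a local informationally complete
   measurement.  If the copies are in the state U(h) rho U(h)^*, then the outcomes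
   determine the coset h Sym(rho) up to an error O(1/s) (Chebyshev), which is
   enough to undo U(h) on the input of E^(n') and to restore U'(h) on its output.
   Twirling with shared randomness makes the protocol covariant, and surplus
   output copies are discarded. *)

(* Covariance must hold exactly for every number of copies, while the estimate of the group element
   can always fail. Averaging over the group is exact whatever the inner protocol does, so a wrong
   estimate only affects the distance to the target. In exchange the inner protocol has to be good
   on every state [conjm (U h) rho], which a single constant [inv_gap] ensures because [G] is
   finite. The Chebyshev bound is carried out on channels: the record of outcomes is an argument of
   a recursive LOCC map, and the mean of a potential, the summed squared deviations of the counts,
   is bounded copy by copy along this recursion. A failed estimate costs at most 2 in trace norm and
   forces the potential to be at least of order [s ^ 2], while its mean is at most [s]; hence the
   error of order [1 / s]. Norm estimates rest on the duality between the trace norm and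
   contractions. *)
Require Import Defs.
From mathcomp Require Import ring lra.

Set Implicit Arguments.
Unset Strict Implicit.
Unset Printing Implicit Defensive.

Import Order.TTheory GRing.Theory Num.Theory.
Import numFieldNormedType.Exports.

Local Open Scope sesquilinear_scope.
Local Open Scope ring_scope.

(** * Trace norm *)

Section Adjoint.
Variable C : numClosedFieldType.

Lemma adjmxM m n p (X : 'M[C]_(m, n)) (Y : 'M[C]_(n, p)) :
  (X *m Y)^t* = Y^t* *m X^t*.
Proof. by rewrite trmx_mul map_mxM. Qed.

Lemma adjmxB m n (X Y : 'M[C]_(m, n)) : (X - Y)^t* = X^t* - Y^t*.
Proof. by rewrite linearB /= map_mxB. Qed.

Lemma adjmxD m n (X Y : 'M[C]_(m, n)) : (X + Y)^t* = X^t* + Y^t*.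
Proof. by rewrite linearD /= map_mxD. Qed.

Lemma adjmxZ m n (c : C) (X : 'M[C]_(m, n)) : (c *: X)^t* = c^* *: X^t*.
Proof. by rewrite linearZ /= map_mxZ. Qed.

Lemma adjmx1 n : (1%:M : 'M[C]_n)^t* = 1%:M.
Proof. by rewrite trmx1 map_mx1. Qed.

Lemma adjmx_diag n (d : 'rV[C]_n) :
  (diag_mx d)^t* = diag_mx (map_mx Num.conj d).
Proof. by rewrite tr_diag_mx map_diag_mx. Qed.

Lemma unitarymxPl n (V : 'M[C]_n) : V \is unitarymx -> V^t* *m V = 1%:M.
Proof. by move=> VU; rewrite -invmx_unitary // mulVmx // unitarymx_unit. Qed.

Lemma mulmx_delta_entry m n (X : 'M[C]_(m, n)) (i : 'I_m) (j : 'I_n) :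
  (delta_mx 0 i *m X *m delta_mx j 0 : 'M_(1, 1)) 0 0 = X i j.
Proof. by rewrite -rowE -colE !mxE. Qed.

Lemma adjmx_delta m n (i : 'I_m) (j : 'I_n) :
  (delta_mx i j : 'M[C]_(m, n))^t* = delta_mx j i.
Proof.
by apply/matrixP=> a b; rewrite !mxE rmorph_nat andbC.
Qed.

Lemma mxtrace_cycle n (V D W M : 'M[C]_n) :
  \tr (V *m D *m W *m M) = \tr (D *m (W *m M *m V)).
Proof. by rewrite -!mulmxA mxtrace_mulC !mulmxA. Qed.

Lemma mxtrace_diag_conj n (V : 'M[C]_n) (d : 'rV[C]_n) : V \is unitarymx ->
  \tr (V^t* *m diag_mx d *m V) = \sum_i d 0 i.
Proof.
by move=> VU; rewrite mxtrace_mulC mulmxA (unitarymxP VU) mul1mx mxtrace_diag.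
Qed.

Lemma mul_diag_conj n (V : 'M[C]_n) (d e : 'rV[C]_n) : V \is unitarymx ->
  (V^t* *m diag_mx d *m V) *m (V^t* *m diag_mx e *m V) =
  V^t* *m diag_mx (\row_i (d 0 i * e 0 i)) *m V.
Proof.
by move=> VU; rewrite !mulmxA mulmxtVK // -mulmx_diag !mulmxA.
Qed.

Lemma diag_mx_sub1 n (d : 'rV[C]_n) :
  1%:M - diag_mx d = diag_mx (\row_i (1 - d 0 i)).
Proof.
rewrite -diag_const_mx -linearB /=; congr diag_mx.
by apply/rowP=> i; rewrite !mxE.
Qed.

Lemma diag_mx_subE n (d e : 'rV[C]_n) :
  diag_mx d - diag_mx e = diag_mx (\row_i (d 0 i - e 0 i)).
Proof.
by rewrite -linearB /=; congr diag_mx; apply/rowP=> i; rewrite !mxE.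
Qed.

End Adjoint.

Section TraceNorm.
Variable R : realType.
Local Notation C := (complex R).

Lemma psd_conj m n (K : 'M[C]_(m, n)) X : psd X -> psd (K *m X *m K^t*).
Proof.
move=> X0 v; have := X0 (K^t* *m v).
by rewrite adjmxM trmxCK !mulmxA.
Qed.

Lemma psd_conjl m n (K : 'M[C]_(n, m)) X : psd X -> psd (K^t* *m X *m K).
Proof. by move=> X0; have := psd_conj (K^t*) X0; rewrite trmxCK. Qed.

Lemma psd0 n : psd (0 : 'M[C]_n).
Proof. by move=> v; rewrite mulmx0 mul0mx mxE. Qed.

Lemma psdD n (X Y : 'M[C]_n) : psd X -> psd Y -> psd (X + Y).
Proof.
by move=> X0 Y0 v; rewrite mulmxDr mulmxDl mxE addr_ge0 // ?X0 ?Y0.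
Qed.

Lemma psd_sum (I : finType) (P : pred I) n (F : I -> 'M[C]_n) :
  (forall i, P i -> psd (F i)) -> psd (\sum_(i | P i) F i).
Proof. move=> F0; apply: (big_ind (@psd R n)); [exact: psd0 | | exact: F0].
by move=> X Y; apply: psdD.
Qed.

Lemma psd1 n : psd (1%:M : 'M[C]_n).
Proof.
move=> v; rewrite mulmx1 mxE sumr_ge0 // => i _.
by rewrite !mxE mulrC mul_conjC_ge0.
Qed.

Lemma psd_gram m n (X : 'M[C]_(m, n)) : psd (X *m X^t*).
Proof. by rewrite -[X in X *m _]mulmx1; apply/psd_conj/psd1. Qed.

Lemma psd_diag n (d : 'rV[C]_n) : (forall i, 0 <= d 0 i) -> psd (diag_mx d).
Proof.
move=> d0 v; rewrite -mulmxA mxE sumr_ge0 // => i _.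
rewrite mul_diag_mx !mxE mulrCA mulr_ge0 //.
by rewrite mulrC mul_conjC_ge0.
Qed.

Lemma psd_entry_ge0 n (X : 'M[C]_n) i : psd X -> 0 <= X i i.
Proof.
move=> X0; have := X0 (delta_mx i 0).
by rewrite adjmx_delta mulmx_delta_entry.
Qed.

(** The quadratic form of [X^t* - X] vanishes because that of [X] is real; polarization with the
    coefficients 1 and ['i] then kills every entry. *)
Lemma psd_herm n (X : 'M[C]_n) : psd X -> X^t* = X.
Proof.
move=> X0; pose Y := X^t* - X; apply/eqP; rewrite -subr_eq0; apply/eqP.
have Y0 (v : 'cV_n) : (v^t* *m Y *m v) 0 0 = 0.
  have /ger0_real/CrealP X1 := X0 v.
  have: ((v^t* *m X *m v)^t*) 0 0 = (v^t* *m X *m v) 0 0.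
    by rewrite -[RHS]X1 mxE; congr (_^*); rewrite mxE.
  rewrite !adjmxM trmxCK mulmxA => E.
  by rewrite /Y mulmxBr mulmxBl mxE E [X in _ + X]mxE subrr.
rewrite -/Y; apply/matrixP=> i j; rewrite [RHS]mxE.
pose q (u w : 'cV[C]_n) : C := (u^t* *m Y *m w) 0 0.
have qDl u u' w : q (u + u') w = q u w + q u' w.
  by rewrite /q adjmxD !mulmxDl mxE.
have qDr u w w' : q u (w + w') = q u w + q u w'.
  by rewrite /q mulmxDr mxE.
have qZl c u w : q (c *: u) w = c^* * q u w.
  by rewrite /q adjmxZ -!scalemxAl mxE.
have qZr c u w : q u (c *: w) = c * q u w.
  by rewrite /q -scalemxAr mxE.
have qD u u' w w' c : q (u + c *: u') (w + c *: w') =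
    q u w + c * q u w' + (c^* * q u' w + c^* * (c * q u' w')).
  by rewrite qDl !qDr !qZl !qZr.
pose e a : 'cV[C]_n := delta_mx a 0.
have YE a b : q (e a) (e b) = Y a b.
  by rewrite /q /e adjmx_delta mulmx_delta_entry.
have diag a : Y a a = 0 by rewrite -YE; apply: Y0.
have pol c : c * Y i j + c^* * Y j i = 0.
  have := Y0 (e i + c *: e j); rewrite -/(q _ _) qD !YE !diag.
  by rewrite !mulr0 add0r addr0.
have := pol 1; have := pol 'i%R; rewrite conjCi conjC1 !mul1r mulNr -mulrBr.
move/eqP; rewrite mulf_eq0 (negbTE (neq0Ci _)) /= => /eqP Y1 Y2.
have : 2 * Y i j = (Y i j - Y j i) + (Y i j + Y j i) by ring.
by rewrite Y1 Y2 addr0 => /eqP; rewrite mulf_eq0 pnatr_eq0 /= => /eqP.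
Qed.

Lemma herm_spectral n (X : 'M[C]_n) : X^t* = X ->
  exists2 V : 'M[C]_n, V \is unitarymx &
  exists2 d : 'rV[C]_n, (forall i, d 0 i \is Num.real) &
    X = V^t* *m diag_mx d *m V.
Proof.
move=> XH; have Xh : X \is hermsymmx.
  by apply/is_hermitianmxP; rewrite expr0 scale1r XH.
exists (spectralmx X); first exact: spectral_unitarymx.
exists (spectral_diag X).
  by move=> i; apply/mxOverP/hermitian_spectral_diag_real.
rewrite -invmx_unitary ?spectral_unitarymx //.
exact/orthomx_spectralP/hermitian_normalmx.
Qed.

Lemma psd_spectral n (X : 'M[C]_n) : psd X ->
  exists2 V : 'M[C]_n, V \is unitarymx &
  exists2 d : 'rV[C]_n, (forall i, 0 <= d 0 i) &
    X = V^t* *m diag_mx d *m V.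
Proof.
move=> X0; have [V VU [d _ XE]] := herm_spectral (psd_herm X0).
exists V => //; exists d => // i.
have := psd_entry_ge0 i (psd_conj V X0).
rewrite XE !mulmxA mulmxtVK // (unitarymxP VU) mul1mx mxE eqxx mulr1n.
by [].
Qed.

(** Operator norm at most 1, written as [M M^* <= 1]. Contractions form the dual unit ball of the
    trace norm. *)
Definition contraction m n (M : 'M[C]_(m, n)) := psd (1%:M - M *m M^t*).

Lemma contraction_row m n (M : 'M[C]_(m, n)) i :
  contraction M -> \sum_j `|M i j| ^+ 2 <= 1.
Proof.
move=> /(psd_entry_ge0 i); rewrite !mxE eqxx mulr1n subr_ge0.
by under eq_bigr do rewrite !mxE -normCK.
Qed.

Lemma contraction_unitaryl m n (V : 'M[C]_m) (M : 'M[C]_(m, n)) :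
  V \is unitarymx -> contraction M -> contraction (V *m M).
Proof.
move=> /unitarymxP VU /(psd_conj V).
by rewrite mulmxBr mulmxBl mulmx1 VU /contraction adjmxM !mulmxA.
Qed.

Lemma contraction_unitaryr m n (V : 'M[C]_n) (M : 'M[C]_(m, n)) :
  V \is unitarymx -> contraction M -> contraction (M *m V).
Proof.
by move=> VU; rewrite /contraction adjmxM mulmxA mulmxtVK.
Qed.

(* The columns of [X *m V^t*] are orthogonal, and their norms [d i] are the
   singular values of [X]; this takes the place of a polar decomposition. *)
Lemma trnorm_gram n (X : 'M[C]_n) :
  exists2 V : 'M[C]_n, V \is unitarymx &
  exists2 d : 'I_n -> C, (forall i, 0 <= d i) &
    ((X *m V^t*)^t* *m (X *m V^t*) = diag_mx (\row_i d i ^+ 2))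
    /\ (trnorm X)%:C%C = \sum_i d i.
Proof.
have P0 : psd (X^t* *m X) by have := psd_gram (X^t*); rewrite trmxCK.
have VU := spectral_unitarymx (X^t* *m X).
set V := spectralmx _ in VU *.
have PE : X^t* *m X = V^t* *m diag_mx (spectral_diag (X^t* *m X)) *m V.
  rewrite -invmx_unitary //; apply/orthomx_spectralP/hermitian_normalmx.
  by apply/is_hermitianmxP; rewrite expr0 scale1r (psd_herm P0).
set D := spectral_diag _ in PE.
have DE : V *m (X^t* *m X) *m V^t* = diag_mx D.
  by rewrite PE !mulmxA mulmxtVK // (unitarymxP VU) mul1mx.
have D0 i : 0 <= D 0 i.
  have := psd_entry_ge0 i (psd_conj V P0).
  by rewrite DE mxE eqxx mulr1n.
exists V => //; exists (fun i => sqrtC (D 0 i)).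
  by move=> i; rewrite sqrtC_ge0.
split.
  rewrite adjmxM trmxCK mulmxA -[V *m _ *m X]mulmxA DE.
  by congr diag_mx; apply/rowP=> i; rewrite mxE sqrtCK.
rewrite /trnorm /sqrtmx -/V -/D invmx_unitary //.
rewrite mxtrace_mulC mulmxA (unitarymxP VU) mul1mx mxtrace_diag.
have -> : \sum_i (map_mx sqrtC D) 0 i = \sum_i sqrtC (D 0 i).
  by apply: eq_bigr => i _; rewrite mxE.
by rewrite RRe_real // ger0_real // sumr_ge0 // => i _; rewrite sqrtC_ge0.
Qed.

Lemma cauchy_le (I : finType) (x y : I -> C) (b c : C) : 0 <= b -> 0 <= c ->
  \sum_i `|x i| ^+ 2 <= b ^+ 2 -> \sum_i `|y i| ^+ 2 <= c ^+ 2 ->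
  `|\sum_i x i * y i| <= b * c.
Proof.
move=> b0 c0 xb yc.
apply: le_trans (ler_norm_sum _ _ _) _.
under eq_bigr do rewrite normrM.
have [b00|bp] := eqVneq b 0.
  have x0 i : `|x i| = 0.
    have /psumr_eq0P x0 : \sum_i `|x i| ^+ 2 = 0.
      apply/eqP; rewrite eq_le (le_trans xb) ?b00 ?expr0n //=.
      by apply: sumr_ge0 => k _; rewrite exprn_ge0.
    apply/eqP; have := x0 (fun k _ => exprn_ge0 2 (normr_ge0 _)) i isT.
    by move/eqP; rewrite expf_eq0.
  by rewrite b00 mul0r big1 // => i _; rewrite x0 mul0r.
have [c00|cp] := eqVneq c 0.
  have y0 i : `|y i| = 0.
    have /psumr_eq0P y0 : \sum_i `|y i| ^+ 2 = 0.
      apply/eqP; rewrite eq_le (le_trans yc) ?c00 ?expr0n //=.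
      by apply: sumr_ge0 => k _; rewrite exprn_ge0.
    apply/eqP; have := y0 (fun k _ => exprn_ge0 2 (normr_ge0 _)) i isT.
    by move/eqP; rewrite expf_eq0.
  by rewrite c00 mulr0 big1 // => i _; rewrite y0 mulr0.
have b_gt0 : 0 < b by rewrite lt_def bp.
have c_gt0 : 0 < c by rewrite lt_def cp.
(* Young's inequality with the weight [c / b], for which both sums contribute at most [b * c / 2];
   this is why [b = 0] and [c = 0] were treated apart. *)
have key i : `|x i| * `|y i| <=
    (c / b * `|x i| ^+ 2 + b / c * `|y i| ^+ 2) / 2.
  rewrite ler_pdivlMr // -subr_ge0.
  have -> : c / b * `|x i| ^+ 2 + b / c * `|y i| ^+ 2 - `|x i| * `|y i| * 2
      = (c * `|x i| - b * `|y i|) ^+ 2 / (b * c).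
    by field; rewrite bp cp.
  apply: divr_ge0; last exact: mulr_ge0.
  by rewrite real_exprn_even_ge0 // rpredB // rpredM // ger0_real.
apply: le_trans (ler_sum _ (fun i _ => key i)) _.
rewrite -mulr_suml big_split /= -!mulr_sumr.
rewrite ler_pdivrMr //.
have -> : b * c * 2 = c / b * b ^+ 2 + b / c * c ^+ 2.
  by field; rewrite bp cp.
by apply: lerD; apply: ler_wpM2l => //; rewrite divr_ge0.
Qed.

(** After rotation by [V], the i-th diagonal entry pairs a row of a contraction, of norm at most 1,
    with a column of norm [d i]. *)
Lemma trnorm_holder n (X M : 'M[C]_n) : contraction M ->
  `|\tr (X *m M)| <= (trnorm X)%:C%C.
Proof.
move=> Mc; have [V VU [d d0 [XE ->]]] := trnorm_gram X.
have -> : \tr (X *m M) = \tr ((X *m V^t*) *m (V *m M)).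
  by rewrite !mulmxA -[_ *m _ *m V]mulmxA unitarymxPl // mulmx1.
have := contraction_unitaryl VU Mc; move: (V *m M) => N Nc.
rewrite mxtrace_mulC; apply: le_trans (ler_norm_sum _ _ _) _.
apply: ler_sum => i _; rewrite mxE -[leRHS]mul1r.
apply: cauchy_le => //; first by rewrite expr1n contraction_row.
move/matrixP: XE => /(_ i i); rewrite !mxE eqxx mulr1n => <-.
by apply: ler_sum => j _; rewrite !mxE normCKC.
Qed.

(** The optimal contraction is the adjoint of the partial isometry in the polar decomposition. [Dp]
    inverts the singular values, and [0^-1 = 0] takes care of the kernel. *)
Lemma trnorm_attained n (X : 'M[C]_n) :
  exists2 M, contraction M & \tr (X *m M) = (trnorm X)%:C%C.
Proof.
have [V VU [d d0 [XE ->]]] := trnorm_gram X.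
set Y := X *m V^t* in XE.
pose Dp : 'M[C]_n := diag_mx (\row_i (d i)^-1).
have DpE : Dp^t* = Dp.
  rewrite adjmx_diag; congr diag_mx; apply/rowP=> i; rewrite !mxE.
  by apply/CrealP; rewrite ger0_real // invr_ge0.
exists (V^t* *m (Dp *m Y^t*)).
  apply: contraction_unitaryl; first by rewrite trmxC_unitary.
  clearbody Y.
  rewrite /contraction adjmxM trmxCK mulmxA -[_ *m Y]mulmxA.
  rewrite XE DpE.
  rewrite !mulmx_diag diag_mx_sub1; apply: psd_diag => i; rewrite !mxE.
  have [->|dn] := eqVneq (d i) 0; first by rewrite invr0 mulr0 subr0 ler01.
  by rewrite expr2 mulrA mulVf // mul1r divff // subrr.
rewrite mulmxA -/Y mulmxA mxtrace_mulC mulmxA XE mulmx_diag mxtrace_diag.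
apply: eq_bigr => i _; rewrite !mxE.
have [->|dn] := eqVneq (d i) 0; first by rewrite invr0 mulr0.
by rewrite expr2 -mulrA mulfV // mulr1.
Qed.

Lemma trnorm_ge0 n (X : 'M[C]_n) : 0 <= trnorm X.
Proof.
have [M Mc ME] := trnorm_attained X.
by rewrite -lecR; apply: le_trans (normr_ge0 _) (trnorm_holder X Mc).
Qed.

Lemma trnormD n (X Y : 'M[C]_n) : trnorm (X + Y) <= trnorm X + trnorm Y.
Proof.
have [M Mc ME] := trnorm_attained (X + Y).
rewrite -lecR -ME rmorphD /= mulmxDl linearD /=.
apply: le_trans (lerD (trnorm_holder X Mc) (trnorm_holder Y Mc)).
apply: le_trans (ler_normD _ _); apply: real_ler_norm.
by rewrite -linearD -mulmxDl /= ME complex_real.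
Qed.

Lemma trnorm_le n (X : 'M[C]_n) (b : R) :
  (forall M, contraction M -> `|\tr (X *m M)| <= b%:C%C) -> trnorm X <= b.
Proof.
have [M Mc ME] := trnorm_attained X; move=> /(_ M Mc).
by rewrite ME ger0_norm ?lecR ?ler0c ?trnorm_ge0 // => ->.
Qed.

Lemma trnormZ n (c : R) (X : 'M[C]_n) : 0 <= c ->
  trnorm (c%:C%C *: X) <= c * trnorm X.
Proof.
move=> c0; apply: trnorm_le => M Mc.
rewrite -scalemxAl linearZ /= normrM rmorphM /= ger0_norm ?ler0c //.
by rewrite ler_wpM2l ?ler0c // trnorm_holder.
Qed.

Lemma trnorm0 n : trnorm (0 : 'M[C]_n) = 0.
Proof.
apply/eqP; rewrite eq_le trnorm_ge0 andbT; apply: trnorm_le => M _.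
by rewrite mul0mx linear0 normr0.
Qed.

Lemma trnorm_sum (I : finType) n (X : I -> 'M[C]_n) :
  trnorm (\sum_i X i) <= \sum_i trnorm (X i).
Proof.
elim/big_ind2: _ => //; first by rewrite trnorm0.
by move=> Y1 y1 Y2 y2 Y1y Y2y; apply: le_trans (trnormD _ _) (lerD Y1y Y2y).
Qed.

Lemma trnormB n (X Y : 'M[C]_n) : trnorm (X - Y) <= trnorm X + trnorm Y.
Proof.
apply: trnorm_le => M Mc; rewrite mulmxBl linearB /= rmorphD /=.
apply: le_trans (ler_normB _ _) _.
by apply: lerD; apply: trnorm_holder.
Qed.

Lemma trnormN n (X : 'M[C]_n) : trnorm (- X) <= trnorm X.
Proof.
apply: trnorm_le => M Mc; rewrite mulNmx linearN normrN.
exact: (trnorm_holder X Mc).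
Qed.

Lemma trnormC n (X Y : 'M[C]_n) : trnorm (X - Y) = trnorm (Y - X).
Proof.
have le Z1 Z2 : trnorm (Z1 - Z2 : 'M[C]_n) <= trnorm (Z2 - Z1).
  by have := trnormN (Z2 - Z1); rewrite opprB.
by apply/le_anti/andP; split; exact: le.
Qed.

Lemma trnorm_unitary n (V X : 'M[C]_n) : V \is unitarymx ->
  trnorm (V *m X *m V^t*) <= trnorm X.
Proof.
move=> VU; apply: trnorm_le => M Mc.
rewrite -!mulmxA mxtrace_mulC -!mulmxA.
have V'U : V^t* \is unitarymx by rewrite trmxC_unitary.
have := contraction_unitaryr VU (contraction_unitaryl V'U Mc).
rewrite -mulmxA; exact: (trnorm_holder X).
Qed.

Lemma contraction_entry m n (M : 'M[C]_(m, n)) i j :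
  contraction M -> `|M i j| <= 1.
Proof.
move=> /(contraction_row i); rewrite (bigD1 j) //= => Mi.
rewrite -(@ler_pXn2r _ 2) ?nnegrE // expr1n; apply: le_trans Mi.
by rewrite lerDl sumr_ge0 // => k _; rewrite exprn_ge0.
Qed.

Lemma contraction_diag n (d : 'rV[C]_n) :
  (forall i, `|d 0 i| <= 1) -> contraction (diag_mx d).
Proof.
move=> d1; rewrite /contraction adjmx_diag mulmx_diag diag_mx_sub1.
apply: psd_diag => i; rewrite !mxE -normCK subr_ge0.
by rewrite exprn_ile1.
Qed.

(** Splitting off the positive and negative spectral parts reduces contractivity of a channel on
    Hermitian operators to positivity and trace preservation. *)
Lemma herm_jordan n (X : 'M[C]_n) : X^t* = X ->
  exists P N : 'M[C]_n, [/\ psd P, psd N, X = P - N &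
    \tr P + \tr N <= (trnorm X)%:C%C].
Proof.
move=> /herm_spectral [V VU [d dr XE]].
have V'U : V^t* \is unitarymx by rewrite trmxC_unitary.
pose p : 'rV[C]_n := \row_i ((`|d 0 i| + d 0 i) / 2).
pose q : 'rV[C]_n := \row_i ((`|d 0 i| - d 0 i) / 2).
exists (V^t* *m diag_mx p *m V), (V^t* *m diag_mx q *m V); split.
- apply: psd_conjl; apply: psd_diag => i; rewrite mxE divr_ge0 //.
  by rewrite -lerBlDr sub0r -normrN real_ler_norm // rpredN.
- apply: psd_conjl; apply: psd_diag => i; rewrite mxE divr_ge0 //.
  by rewrite subr_ge0 real_ler_norm.
- rewrite XE -mulmxBl -mulmxBr diag_mx_subE; congr (_ *m diag_mx _ *m _).
  by apply/rowP=> i; rewrite !mxE; field.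
rewrite (mxtrace_diag_conj p VU) (mxtrace_diag_conj q VU) -big_split.
(* The sign of [X] is a contraction, and its pairing with [X] is the sum of the absolute
   eigenvalues. *)
pose s : 'rV[C]_n := \row_i (if 0 <= d 0 i then 1 else -1).
have Mc : contraction (V^t* *m diag_mx s *m V).
  apply: (contraction_unitaryr VU); apply: (contraction_unitaryl V'U).
  apply: contraction_diag => i; rewrite mxE.
  by case: ifP; rewrite ?normrN normr1.
apply: le_trans (trnorm_holder X Mc).
rewrite XE (mul_diag_conj d s VU) mxtrace_diag_conj //.
apply: le_trans (real_ler_norm _); last first.
  apply: rpred_sum => i _; rewrite !mxE; case: ifP => _; rewrite ?mulr1 ?mulrN1.
    exact: dr.
  by rewrite rpredN dr.
apply: ler_sum => i _; rewrite /= !mxE.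
have := dr i; rewrite realE; case: ifP => [d0 _|_ /= d0].
  by rewrite ger0_norm // le_eqVlt; apply/orP; left; apply/eqP; field.
by rewrite ler0_norm // le_eqVlt; apply/orP; left; apply/eqP; field.
Qed.

Lemma trnorm_psd n (X : 'M[C]_n) : psd X -> (trnorm X)%:C%C <= \tr X.
Proof.
move=> X0; have [M Mc ME] := trnorm_attained X.
have [V VU [d d0 XE]] := psd_spectral X0.
have -> : \tr X = \sum_i d 0 i.
  by rewrite XE mxtrace_mulC mulmxA (unitarymxP VU) mul1mx mxtrace_diag.
have V'U : V^t* \is unitarymx by rewrite trmxC_unitary.
have := contraction_unitaryr V'U (contraction_unitaryl VU Mc).
set N := _ *m V^t* => Nc.
have trE : \tr (X *m M) = \sum_i d 0 i * N i i.
  transitivity (\tr (diag_mx d *m N)).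
    by rewrite XE mxtrace_cycle.
  by apply: eq_bigr => i _; rewrite mul_diag_mx mxE.
have <- : `|\tr (X *m M)| = (trnorm X)%:C%C.
  by rewrite ME ger0_norm // ler0c trnorm_ge0.
rewrite trE; apply: le_trans (ler_norm_sum _ _ _) _.
apply: ler_sum => i _; rewrite normrM (ger0_norm (d0 i)).
by rewrite ler_piMr // (contraction_entry i i Nc).
Qed.

(** Each entry of [X] is its pairing with a matrix unit, which is a contraction. *)
Lemma trnorm_eq0 n (X : 'M[C]_n) : trnorm X = 0 -> X = 0.
Proof.
move=> X0; apply/matrixP=> i j; rewrite [RHS]mxE.
have Mc : contraction (delta_mx j i : 'M[C]_n).
  rewrite /contraction adjmx_delta mul_delta_mx.
  have -> : 1%:M - delta_mx j j = diag_mx (\row_k (k != j)%:R) :> 'M[C]_n.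
    apply/matrixP=> a b; rewrite !mxE.
    have [<-|ab] := eqVneq a b.
      by case: (a == j); rewrite /= ?subrr ?subr0.
    have -> : (a == j) && (b == j) = false.
      by apply: contraNF ab => /andP[/eqP -> /eqP ->].
    by rewrite subrr mulr0n.
  by apply: psd_diag => k; rewrite mxE ler0n.
have := trnorm_holder X Mc; rewrite X0 normr_le0 => /eqP.
suff -> : \tr (X *m delta_mx j i) = X i j by [].
rewrite /mxtrace (bigD1 i) //= [X in _ + X]big1 => [|k ki].
  rewrite addr0 mxE (bigD1 j) //= big1 => [|l lj]; last first.
    by rewrite mxE (negbTE lj) mulr0.
  by rewrite mxE !eqxx mulr1 addr0.
by rewrite mxE big1 // => l _; rewrite mxE (negbTE ki) andbF mulr0.
Qed.

End TraceNorm.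

(** * Kraus operators and tensor products *)

(** The label types differ from party to party, so products of local sums expand over dependent
    functions; the tagged union of the types gives access to the non-dependent expansion. *)
Lemma bigA_distr_dffun (F : comNzRingType) (I : finType) (T : I -> finType)
    (f : forall i, T i -> F) :
  \prod_i \sum_(a : T i) f i a =
  \sum_(a : {dffun forall i, T i}) \prod_i f i (a i).
Proof.
transitivity (\prod_i \sum_(a : T i) [ffun a => f i a] a).
  by apply: eq_bigr => i _; apply: eq_bigr => a _; rewrite ffunE.
under eq_bigr => i _ do rewrite (big_tag (fun i => [ffun a => f i a])).
rewrite bigA_distr_big_dep.
rewrite -(@big_fprod _ _ _ _ _ _ _ (fun i => [ffun a => f i a])).
rewrite (reindex (@fprod_of_dffun _ T)); last exact/onW_bij/fprod_of_dffun_bij.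
apply: eq_bigr => a _; apply: eq_bigr => i _; rewrite ffunE.
by rewrite -[in RHS](fprod_of_dffunK a) ffunE.
Qed.

Lemma linear_lincomb (F : pzRingType) (V W : lmodType F) (f : V -> W)
    (I : finType) (c : I -> F) (v : I -> V) : linear f ->
  f (\sum_i c i *: v i) = \sum_i c i *: f (v i).
Proof.
move=> f_lin; have f0 : f 0 = 0.
  by have := f_lin (-1) 0 0; rewrite !scaleN1r oppr0 addr0 addNr.
apply: (big_ind2 (fun x y => f x = y)) => //.
  by move=> x1 y1 x2 y2 <- <-; rewrite -[x1]scale1r f_lin !scale1r.
by move=> i _; rewrite -[c i *: _]addr0 f_lin f0 addr0.
Qed.

Section Entries.
Variable R : realType.
Local Notation C := (complex R).
Implicit Types S T : finType.

Definition mkrect S T (f : S -> T -> C) : 'M[C]_(#|S|, #|T|) :=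
  \matrix_(i, j) f (enum_val i) (enum_val j).

Lemma ent_mkrect S T (f : S -> T -> C) x y : ent (mkrect f) x y = f x y.
Proof. by rewrite /ent mxE !enum_rankK. Qed.

Lemma ent_mkop T (f : T -> T -> C) x y : ent (mkop f) x y = f x y.
Proof. exact: (ent_mkrect f). Qed.

Lemma ent_inj S T (X Y : 'M[C]_(#|S|, #|T|)) :
  (forall x y, ent X x y = ent Y x y) -> X = Y.
Proof.
move=> XY; apply/matrixP=> i j.
by have := XY (enum_val i) (enum_val j); rewrite /ent !enum_valK.
Qed.

Lemma entZ S T (c : C) (X : 'M[C]_(#|S|, #|T|)) x y :
  ent (c *: X) x y = c * ent X x y.
Proof. by rewrite /ent mxE. Qed.

Lemma ent_sum S T (I : finType) (P : pred I) (X : I -> 'M[C]_(#|S|, #|T|)) x y :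
  ent (\sum_(i | P i) X i) x y = \sum_(i | P i) ent (X i) x y.
Proof. by rewrite /ent summxE. Qed.

Lemma sum_enum_rank T (f : 'I_#|T| -> C) :
  \sum_i f i = \sum_(x : T) f (enum_rank x).
Proof. by rewrite (reindex (@enum_rank T)) //; apply/onW_bij/enum_rank_bij. Qed.

Lemma ent_mul S T (Q : finType) (X : 'M[C]_(#|S|, #|Q|))
    (Y : 'M[C]_(#|Q|, #|T|)) x y :
  ent (X *m Y) x y = \sum_z ent X x z * ent Y z y.
Proof. by rewrite /ent mxE sum_enum_rank. Qed.

Lemma ent_adj S T (X : 'M[C]_(#|S|, #|T|)) x y :
  ent (X^t*) x y = (ent X y x)^*.
Proof. by rewrite /ent !mxE. Qed.

Lemma ent1 T (x y : T) : ent (1%:M : op R T) x y = (x == y)%:R.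
Proof. by rewrite /ent mxE (inj_eq enum_rank_inj). Qed.

Lemma ent_ketbra T (a b x y : T) :
  ent (ketbra R a b) x y = ((x == a) && (y == b))%:R.
Proof. by rewrite /ent mxE !(inj_eq enum_rank_inj). Qed.

Lemma mxtrace_ent T (X : op R T) : \tr X = \sum_x ent X x x.
Proof. by rewrite /mxtrace sum_enum_rank. Qed.

Lemma sum_delta T (f : T -> C) a : \sum_x (x == a)%:R * f x = f a.
Proof.
rewrite (bigD1 a) //= eqxx mul1r big1 ?addr0 // => x /negbTE ->.
by rewrite mul0r.
Qed.

Lemma op_lincomb T (X : op R T) :
  X = \sum_(p : T * T) ent X p.1 p.2 *: ketbra R p.1 p.2.
Proof.
apply: ent_inj => x y; rewrite ent_sum.
rewrite (bigD1 (x, y)) //= entZ ent_ketbra !eqxx mulr1 big1 ?addr0 //.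
move=> [a b] /= ab; rewrite entZ ent_ketbra.
suff -> : (x == a) && (y == b) = false by rewrite mulr0.
by apply: contraNF ab => /andP[/eqP -> /eqP ->].
Qed.

Lemma ent_conj S T (K L : 'M[C]_(#|T|, #|S|)) (X : op R S) s t :
  ent (K *m X *m L^t*) s t =
  \sum_(p : S * S) ent X p.1 p.2 * (ent K s p.1 * (ent L t p.2)^*).
Proof.
rewrite ent_mul -(pair_bigA _ (fun x y => ent X x y * (ent K s x * (ent L t y)^*))).
rewrite exchange_big /=; apply: eq_bigr => y _.
by rewrite ent_adj ent_mul mulr_suml; apply: eq_bigr => x _; ring.
Qed.

Definition kraus S T (I : finType) (K : I -> 'M[C]_(#|T|, #|S|)) (X : op R S) :
    op R T :=
  \sum_a K a *m X *m (K a)^t*.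

Lemma ent_kraus S T (I : finType) (K : I -> 'M[C]_(#|T|, #|S|)) X s t :
  ent (kraus K X) s t = \sum_a
  \sum_(p : S * S) ent X p.1 p.2 * (ent (K a) s p.1 * (ent (K a) t p.2)^*).
Proof. by rewrite ent_sum; apply: eq_bigr => a _; apply: ent_conj. Qed.

Lemma kraus_linear S T (I : finType) (K : I -> 'M[C]_(#|T|, #|S|)) :
  linear (kraus K).
Proof.
move=> c X Y; rewrite /kraus scaler_sumr -big_split /=.
by apply: eq_bigr => a _; rewrite mulmxDr mulmxDl -scalemxAr -scalemxAl.
Qed.

Lemma kraus_psd S T (I : finType) (K : I -> 'M[C]_(#|T|, #|S|)) X :
  psd X -> psd (kraus K X).
Proof. by move=> X0; apply: psd_sum => a _; apply: psd_conj X0. Qed.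

Lemma kraus_trace S T (I : finType) (K : I -> 'M[C]_(#|T|, #|S|)) X :
  \tr (kraus K X) = \tr ((\sum_a (K a)^t* *m K a) *m X).
Proof.
rewrite /kraus mulmx_suml !linear_sum /=; apply: eq_bigr => a _.
by rewrite mxtrace_mulC mulmxA.
Qed.

Lemma kraus_cp S T (I : finType) (K : I -> 'M[C]_(#|T|, #|S|)) :
  completely_positive (kraus K).
Proof.
split=> [|Q X X0]; first exact: kraus_linear.
(* The ampliation has the Kraus operators [1 (x) K a]. *)
pose L a : 'M[C]_(#|((Q * T)%type : finType)|, #|((Q * S)%type : finType)|) :=
  mkrect (fun p q => (q.1 == p.1)%:R * ent (K a) p.2 q.2).
have -> : ampliation (kraus K) X = kraus L X; last exact: kraus_psd.
apply: ent_inj => -[p s] [q t]; rewrite ent_mkop !ent_kraus /=.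
apply: eq_bigr => a _; symmetry.
pose g (u w : Q * S) := ent X u w *
  ((u.1 == p)%:R * ent (K a) s u.2 * ((w.1 == q)%:R * ent (K a) t w.2)^*).
transitivity (\sum_u \sum_w g u w).
  rewrite pair_bigA; apply: eq_bigr => -[u w] _ /=.
  by rewrite /g /L !ent_mkrect.
transitivity (\sum_u1 \sum_u2 \sum_w1 \sum_w2 g (u1, u2) (w1, w2)).
  rewrite (pair_bigA _ (fun u1 u2 => \sum_w1 \sum_w2 g (u1, u2) (w1, w2))).
  apply: eq_bigr => -[u1 u2] _ /=.
  rewrite (pair_bigA _ (fun w1 w2 => g (u1, u2) (w1, w2))).
  by apply: eq_bigr => -[w1 w2] _.
rewrite (bigD1 p) //= [X in _ + X]big1 ?addr0; last first.
  move=> u1 /negbTE u1p; rewrite !(big1, mulr0, mul0r) // => u2 _.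
  by do 2![rewrite big1 // => ? _]; rewrite /g /= u1p !(mul0r, mulr0).
rewrite -(pair_bigA _ (fun x y => ent (mkop (fun x y => ent X (p, x) (q, y))) x y
  * (ent (K a) s x * (ent (K a) t y)^*))) /=.
apply: eq_bigr => u2 _.
rewrite (bigD1 q) //= [X in _ + X]big1 ?addr0; last first.
  move=> w1 /negbTE w1p; rewrite big1 // => w2 _.
  by rewrite /g /= w1p !(mul0r, rmorph0, mulr0).
by apply: eq_bigr => w2 _; rewrite /g /= !eqxx !mul1r ent_mkop.
Qed.

(* Factor the Choi matrix, the image of the unnormalized maximally entangled
   state under the ampliation of [F]. *)
Lemma cp_kraus S T (F : op R S -> op R T) : completely_positive F ->
  exists K : 'I_#|((S * T)%type : finType)| -> 'M[C]_(#|T|, #|S|), F = kraus K.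
Proof.
move=> [F_lin F_cp].
pose w : 'M[C]_(#|((S * S)%type : finType)|, #|(unit : finType)|) :=
  mkrect (fun p _ => (p.1 == p.2)%:R).
have W0 : psd (w *m w^t*) by apply: psd_gram.
have [V VU [d d0 VE]] := psd_spectral (F_cp _ _ W0).
have Fk x y s t : ent (F (ketbra R x y)) s t =
    \sum_k (d 0 k * (V k (enum_rank (x, s)))^* * V k (enum_rank (y, t))).
  transitivity (ent (ampliation F (w *m w^t*)) (x, s) (y, t)).
    rewrite ent_mkop /=; congr (ent (F _) s t); apply: ent_inj => a b.
    rewrite ent_mkop ent_mul (big_pred1 tt) => [|[]//].
    rewrite ent_adj !ent_mkrect /= ent_ketbra rmorph_nat -natrM mulnb.
    by rewrite (eq_sym x) (eq_sym y).
  rewrite VE /ent mxE; apply: eq_bigr => k _.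
  by rewrite mul_mx_diag !mxE; ring.
exists (fun k => mkrect (fun s x => sqrtC (d 0 k) * (V k (enum_rank (x, s)))^*)).
apply/funext => X; rewrite [in LHS](op_lincomb X) linear_lincomb //.
apply: ent_inj => s t; rewrite ent_sum ent_kraus exchange_big /=.
apply: eq_bigr => -[x y] _ /=; rewrite entZ Fk mulr_sumr.
apply: eq_bigr => k _; rewrite !ent_mkrect [(_ * _^*)^*]rmorphM /= conjCK.
have /CrealP -> : sqrtC (d 0 k) \is Num.real by rewrite ger0_real // sqrtC_ge0.
rewrite -[in LHS](sqrtCK (d 0 k)); ring.
Qed.

End Entries.

Section Tensor.
Variables (R : realType) (m : nat).
Local Notation C := (complex R).
Implicit Types S T W : 'I_m -> finType.

Definition tens S T (K : forall i, 'M[C]_(#|T i|, #|S i|)) :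
    'M[C]_(#|joint T|, #|joint S|) :=
  mkrect (fun x y : joint _ => \prod_i ent (K i) (x i) (y i)).

Lemma tens_mul S T W (K : forall i, 'M[C]_(#|W i|, #|T i|))
    (L : forall i, 'M[C]_(#|T i|, #|S i|)) :
  tens K *m tens L = tens (fun i => K i *m L i).
Proof.
apply: ent_inj => x y; rewrite ent_mul ent_mkrect.
under [RHS]eq_bigr do rewrite ent_mul.
rewrite bigA_distr_dffun; apply: eq_bigr => z _.
by rewrite !ent_mkrect big_split.
Qed.

Lemma tens_adj S T (K : forall i, 'M[C]_(#|T i|, #|S i|)) :
  (tens K)^t* = tens (fun i => (K i)^t*).
Proof.
apply: ent_inj => x y; rewrite ent_adj !ent_mkrect rmorph_prod.
by apply: eq_bigr => i _; rewrite ent_adj.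
Qed.

Lemma tens1 S : tens (fun i => 1%:M : op R (S i)) = 1%:M.
Proof.
apply: ent_inj => x y; rewrite ent_mkrect ent1.
have [->|xy] := eqVneq x y; first by rewrite big1 // => i _; rewrite ent1 eqxx.
have [i xyi] : exists i, x i != y i.
  apply/existsP; apply: contraR xy; rewrite negb_exists => /forallP xy.
  by apply/eqP/ffunP => i; apply/eqP; move: (xy i); rewrite negbK.
by rewrite (bigD1 i) //= ent1 (negbTE xyi) mul0r.
Qed.

Lemma tens_unitary S (u : forall i, op R (S i)) :
  (forall i, u i \is unitarymx) -> tens u \is unitarymx.
Proof.
move=> uU; apply/unitarymxP; rewrite tens_adj tens_mul -tens1.
by congr tens; apply: functional_extensionality_dep => i; apply/unitarymxP.
Qed.

(** Both sides are compared on product matrix units, where the product over the parties of sums over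
    local Kraus indices becomes one sum over tuples of indices. *)
Lemma tensor_map_kraus S T (I : 'I_m -> finType)
    (K : forall i, I i -> 'M[C]_(#|T i|, #|S i|)) :
  tensor_map (fun i => kraus (K i)) =
  kraus (fun a : joint I => tens (fun i => K i (a i))).
Proof.
apply/funext => X; apply: ent_inj => s t; rewrite ent_kraus exchange_big /=.
transitivity (\sum_(x : joint S) \sum_(y : joint S) ent X x y *
    ent (tensor (fun i => kraus (K i) (ketbra R (x i) (y i)))) s t).
  rewrite ent_sum; apply: eq_bigr => x _; rewrite ent_sum.
  by apply: eq_bigr => y _; rewrite entZ.
rewrite pair_bigA; apply: eq_bigr => -[x y] _ /=.
rewrite -mulr_sumr; congr (_ * _); rewrite ent_mkop.
under eq_bigr => i _.
  rewrite ent_kraus.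
  under eq_bigr => a _.
    rewrite (bigD1 (x i, y i)) //= ent_ketbra !eqxx mul1r big1; last first.
      move=> [b c] /= bc; rewrite ent_ketbra.
      suff -> : (b == x i) && (c == y i) = false by rewrite mul0r.
      by apply: contraNF bc => /andP[/eqP -> /eqP ->].
    rewrite addr0.
  over.
over.
rewrite bigA_distr_dffun; apply: eq_bigr => a _.
by rewrite !ent_mkrect rmorph_prod -big_split.
Qed.

End Tensor.

(** * LOCC channels *)

Section Locc.
Variables (R : realType) (m : nat).
Local Notation C := (complex R).
Implicit Types S T W : 'I_m -> finType.

Lemma tensor_map_cp S T (F : forall i, op R (S i) -> op R (T i)) :
  (forall i, completely_positive (F i)) ->
  exists (I : 'I_m -> finType)
    (K : forall i, I i -> 'M[C]_(#|T i|, #|S i|)),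
    tensor_map F = kraus (fun a : joint I => tens (fun i => K i (a i))).
Proof.
move=> Fcp; pose K i := projT1 (cid (cp_kraus (Fcp i))).
exists (fun i => 'I_#|((S i * T i)%type : finType)| : finType), K.
rewrite -tensor_map_kraus; congr tensor_map.
by apply: functional_extensionality_dep => i; rewrite /K; case: cid.
Qed.

Lemma mxtrace_tensor S (X : forall i, op R (S i)) :
  \tr (tensor X) = \prod_i \tr (X i).
Proof.
rewrite mxtrace_ent; under [RHS]eq_bigr do rewrite mxtrace_ent.
by rewrite bigA_distr_dffun; apply: eq_bigr => x _; rewrite ent_mkop.
Qed.

Lemma mxtrace_tensor_map S T (F : forall i, op R (S i) -> op R (T i)) X :
  \tr (tensor_map F X) = \sum_(p : joint S * joint S) ent X p.1 p.2 *
    \prod_i \tr (F i (ketbra R (p.1 i) (p.2 i))).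
Proof.
rewrite -(pair_bigA _ (fun x y : joint S => ent X x y *
  \prod_i \tr (F i (ketbra R (x i) (y i))))) /= linear_sum.
apply: eq_bigr => x _; rewrite linear_sum; apply: eq_bigr => y _.
by rewrite linearZ /= mxtrace_tensor.
Qed.

Lemma mxtrace_ketbra (Q : finType) (x y : Q) :
  \tr (ketbra R x y) = (x == y)%:R.
Proof.
rewrite mxtrace_ent; under eq_bigr do rewrite ent_ketbra -mulnb natrM.
by rewrite (sum_delta (fun z => (z == y)%:R)).
Qed.

Lemma mxtrace_joint S (X : op R (joint S)) :
  \tr X = \sum_(p : joint S * joint S) ent X p.1 p.2 *
    \prod_i \tr (ketbra R (p.1 i) (p.2 i)).
Proof.
rewrite {1}(op_lincomb X) linear_sum; apply: eq_bigr => -[x y] _ /=.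
rewrite linearZ /= -mxtrace_tensor; congr (_ * \tr _).
apply: ent_inj => a b; rewrite ent_ketbra ent_mkop.
under eq_bigr do rewrite ent_ketbra.
have [ab|ab] := boolP ((a == x) && (b == y)).
  by case/andP: ab => /eqP -> /eqP ->; rewrite big1 // => i _; rewrite !eqxx.
have [i abi] : exists i, ~~ ((a i == x i) && (b i == y i)).
  apply/existsP; apply: contraR ab; rewrite negb_exists => /forallP ab.
  by apply/andP; split; apply/eqP/ffunP => i; apply/eqP;
    move: (ab i); rewrite negbK => /andP[].
by rewrite (bigD1 i) //= (negbTE abi) mul0r.
Qed.

(** On product matrix units the trace factorizes. The factors of the parties other than [k] do not
    depend on the outcome, so the sum over [j] only meets the factor of [k]. *)
Lemma mxtrace_round S (J : finType) (W : J -> 'I_m -> finType) (k : 'I_m)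
    (F : forall j i, op R (S i) -> op R (W j i)) X :
  (forall X, \sum_j \tr (F j k X) = \tr X) ->
  (forall j i, i != k -> trace_preserving (F j i)) ->
  \sum_j \tr (tensor_map (F j) X) = \tr X.
Proof.
move=> Fk Fi; under eq_bigr do rewrite mxtrace_tensor_map.
rewrite exchange_big mxtrace_joint; apply: eq_bigr => -[x y] _ /=.
rewrite -mulr_sumr (bigD1 k) //=; congr (_ * _).
rewrite -Fk mulr_suml; apply: eq_bigr => j _; rewrite (bigD1 k) //=.
by congr (_ * _); apply: eq_bigr => i ik; rewrite Fi.
Qed.

Lemma locc_channel S T (L : op R (joint S) -> op R (joint T)) : locc L ->
  [/\ linear L, forall X, psd X -> psd (L X) & forall X, \tr (L X) = \tr X].
Proof.
elim=> {S T L} [S L LE | S T L k J W F E Fcp Fk Fi _ IH LE].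
  by split=> [c X Y|X|X]; rewrite !LE.
split=> [c X Y|X X0|X].
- rewrite !LE scaler_sumr -big_split /=; apply: eq_bigr => j _.
  have [I [K ->]] := tensor_map_cp (Fcp j).
  by rewrite kraus_linear; case: (IH j) => E_lin _ _; rewrite E_lin.
- rewrite LE; apply: psd_sum => j _; case: (IH j) => _ E_psd _; apply: E_psd.
  by have [I [K ->]] := tensor_map_cp (Fcp j); apply: kraus_psd.
rewrite LE linear_sum -(mxtrace_round X Fk Fi); apply: eq_bigr => j _.
by case: (IH j) => _ _ E_tr; apply: E_tr.
Qed.

Lemma linearB_of n p (f : 'M[C]_n -> 'M[C]_p) X Y :
  linear f -> f (X - Y) = f X - f Y.
Proof. by move=> f_lin; rewrite addrC -scaleN1r f_lin scaleN1r addrC. Qed.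

Lemma linearZ_of n p (f : 'M[C]_n -> 'M[C]_p) c X :
  linear f -> f (c *: X) = c *: f X.
Proof.
move=> f_lin; have f0 : f 0 = 0 by rewrite -(subrr X) linearB_of // subrr.
by rewrite -[c *: X]addr0 f_lin f0 addr0.
Qed.

Lemma locc_trnorm S T (L : op R (joint S) -> op R (joint T)) X : locc L ->
  X^t* = X -> trnorm (L X) <= trnorm X.
Proof.
move=> /locc_channel[L_lin L_psd L_tr] /herm_jordan[P [N [P0 N0 XE tr_le]]].
rewrite -lecR; apply: le_trans tr_le.
rewrite -(L_tr P) -(L_tr N) [X in L X]XE linearB_of //.
apply: le_trans (lerD (trnorm_psd (L_psd _ P0)) (trnorm_psd (L_psd _ N0))).
by rewrite -rmorphD /= lecR; apply: trnormB.
Qed.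

(** [L2] is pushed to the leaves of the first protocol; its linearity lets it pass the sum over
    outcomes. *)
Lemma locc_comp S T W (L1 : op R (joint S) -> op R (joint T))
    (L2 : op R (joint T) -> op R (joint W)) :
  locc L1 -> locc L2 -> locc (fun X => L2 (L1 X)).
Proof.
move=> L1_locc; elim: L1_locc L2 => {S T L1}
  [S L LE | S T L k J V F E Fcp Fk Fi _ IH LE] L2 L2_locc.
  by have -> : (fun X => L2 (L X)) = L2 by apply/funext => X; rewrite LE.
apply: (locc_round Fcp Fk Fi (fun j => IH j L2 L2_locc)) => X.
have [L_lin _ _] := locc_channel L2_locc.
rewrite LE; under eq_bigr do rewrite -[E _ _]scale1r.
by rewrite (linear_lincomb _ _ L_lin); under eq_bigr do rewrite scale1r.
Qed.

Definition conjm n p (K : 'M[C]_(n, p)) (X : 'M[C]_p) := K *m X *m K^t*.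

Lemma conjm_kraus (Q Q' : finType) (K : 'M[C]_(#|Q'|, #|Q|)) :
  conjm K = kraus (fun _ : unit => K).
Proof. by apply/funext => X; rewrite /kraus (big_pred1 tt) // => -[]. Qed.

Lemma conjm_cp (Q Q' : finType) (K : 'M[C]_(#|Q'|, #|Q|)) :
  completely_positive (conjm K).
Proof. by rewrite conjm_kraus; apply: kraus_cp. Qed.

Lemma conjmM n p q (K : 'M[C]_(n, p)) (L : 'M[C]_(p, q)) X :
  conjm K (conjm L X) = conjm (K *m L) X.
Proof. by rewrite /conjm adjmxM !mulmxA. Qed.

Lemma conjm1 n (X : 'M[C]_n) : conjm 1%:M X = X.
Proof. by rewrite /conjm adjmx1 mulmx1 mul1mx. Qed.

Lemma conjmZ n p (c : C) (K : 'M[C]_(n, p)) X :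
  conjm (c *: K) X = (c * c^*) *: conjm K X.
Proof.
by rewrite /conjm adjmxZ -!scalemxAl -!scalemxAr scalerA.
Qed.

Lemma conjm_trace n p (K : 'M[C]_(n, p)) X :
  \tr (conjm K X) = \tr (K^t* *m K *m X).
Proof. by rewrite /conjm mxtrace_mulC mulmxA. Qed.

Lemma tensor_map_conjm S T (K : forall i, 'M[C]_(#|T i|, #|S i|)) :
  tensor_map (fun i => conjm (K i)) = conjm (tens K).
Proof.
have -> : (fun i => conjm (K i)) = (fun i => kraus (fun _ : unit => K i)).
  by apply: functional_extensionality_dep => i; apply: conjm_kraus.
rewrite (tensor_map_kraus (fun i (_ : unit) => K i)) conjm_kraus.
apply/funext => X; rewrite /kraus (big_pred1 tt) => [|[]//].
rewrite (big_pred1 [ffun=> tt]) // => a; symmetry; apply/eqP/ffunP => i.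
by rewrite ffunE; case: (a i).
Qed.

Lemma tensZ S T (c : 'I_m -> C) (K : forall i, 'M[C]_(#|T i|, #|S i|)) :
  tens (fun i => c i *: K i) = (\prod_i c i) *: tens K.
Proof.
apply: ent_inj => x y; rewrite entZ !ent_mkrect -big_split /=.
by apply: eq_bigr => i _; rewrite entZ.
Qed.

Variable k0 : 'I_m.

Lemma locc_local S T (F : forall i, op R (S i) -> op R (T i)) :
  (forall i, completely_positive (F i)) ->
  (forall i, trace_preserving (F i)) -> locc (tensor_map F).
Proof.
move=> Fcp Ftp.
apply: (@locc_round R m S T (tensor_map F) k0 unit
  (fun=> T) (fun=> F) (fun=> id)).
- by [].
- by move=> X; rewrite (big_pred1 tt) => [|[]//]; apply: Ftp.
- by move=> _ i _; apply: Ftp.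
- by move=> _; apply: locc_id.
by move=> X; rewrite (big_pred1 tt) // => -[].
Qed.

(** Shared randomness is one round: party [k0] applies the instrument with Kraus operators
    [sqrtC (p j) *: 1], whose outcome is independent of the state, and broadcasts [j]. *)
Lemma locc_mix S T (I : finType) (p : I -> C)
    (L : I -> op R (joint S) -> op R (joint T)) :
  (forall i, 0 <= p i) -> \sum_i p i = 1 -> (forall i, locc (L i)) ->
  locc (fun X => \sum_i p i *: L i X).
Proof.
move=> p0 p1 L_locc.
pose c j i : C := if i == k0 then sqrtC (p j) else 1.
have cc j i : c j i * (c j i)^* = if i == k0 then p j else 1.
  rewrite /c; case: ifP => _; last by rewrite conjC1 mulr1.
  have /CrealP -> : sqrtC (p j) \is Num.real by rewrite ger0_real // sqrtC_ge0.
  by rewrite -expr2 sqrtCK.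
apply: (@locc_round R m S T _ k0 I (fun=> S)
  (fun j i => conjm (c j i *: 1%:M)) L _ _ _ L_locc).
- by move=> j i; apply: conjm_cp.
- move=> X; under eq_bigr do rewrite conjmZ cc eqxx conjm1 linearZ /=.
  by rewrite -mulr_suml p1 mul1r.
- move=> j i ik X; by rewrite conjmZ cc (negbTE ik) scale1r conjm1.
move=> X; apply: eq_bigr => j _.
rewrite tensor_map_conjm tensZ tens1 conjmZ conjm1.
have [L_lin _ _] := locc_channel (L_locc j); rewrite linearZ_of //.
congr (_ *: _); rewrite rmorph_prod -big_split /=.
under [RHS]eq_bigr do rewrite cc.
by rewrite (bigD1 k0) //= eqxx big1 ?mulr1 // => i /negbTE ->.
Qed.

Lemma locc_conj_unitary S (u : forall i, op R (S i)) :
  (forall i, u i \is unitarymx) -> locc (conjm (tens u)).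
Proof.
move=> uU; rewrite -tensor_map_conjm; apply: locc_local => i.
  exact: conjm_cp.
by move=> X; rewrite conjm_trace unitarymxPl // mul1mx.
Qed.

(* The parties in [l] measure one after the other; the outcomes of the others
   are fixed by [c0]. *)
Lemma locc_instrument_seq S T (J : 'I_m -> finType)
    (K : forall i, J i -> op R (S i))
    (E : joint J -> op R (joint S) -> op R (joint T)) :
  (forall i, \sum_j (K i j)^t* *m K i j = 1%:M) -> (forall c, locc (E c)) ->
  forall (l : seq 'I_m) (c0 : joint J), uniq l ->
  locc (fun X => \sum_(c : joint J | [forall i, (i \notin l) ==> (c i == c0 i)])
    E c (conjm (tens (fun i => if i \in l then K i (c i) else 1%:M)) X)).
Proof.
move=> K1 E_locc; elim=> [|k l IH] c0 /=.
  move=> _; set L := (fun X => _); suff -> : L = E c0 by [].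
  apply/funext => X; rewrite /L (big_pred1 c0) => [|c /=].
    by rewrite tens1 conjm1.
  apply/forallP/eqP => [cc0|-> i]; last by rewrite eqxx.
  by apply/ffunP => i; apply/eqP; have := cc0 i.
case/andP=> kl l_uniq.
pose c1 (j : J k) : joint J := [ffun i => dfwith c0 j i].
have c1k j : c1 j k = j by rewrite ffunE dfwith_in.
have c1i j i : i != k -> c1 j i = c0 i.
  by move=> ik; rewrite ffunE dfwith_out // eq_sym.
apply: (@locc_round R m S T _ k (J k) (fun=> S)
  (fun j i => conjm (if i == k then K i (c1 j i) else 1%:M)) _ _ _ _
  (fun j => IH (c1 j) l_uniq)).
- by move=> j i; apply: conjm_cp.
- move=> X; under eq_bigr do rewrite eqxx c1k conjm_trace.
  by rewrite -linear_sum -mulmx_suml K1 mul1mx.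
- by move=> j i ik X; rewrite (negbTE ik) conjm1.
move=> X; rewrite (partition_big (fun c : joint J => c k) predT) //=.
apply: eq_bigr => j _; apply: eq_big => [c|c].
  apply/andP/forallP => [[/forallP cc0 /eqP cj] i|cc1].
    apply/implyP => il; have [->|ik] := eqVneq i k; first by rewrite cj c1k.
    by have := cc0 i; rewrite inE (negbTE ik) il c1i.
  split; last by have := cc1 k; rewrite kl c1k.
  apply/forallP => i; rewrite inE negb_or; apply/implyP => /andP[ik il].
  by have := cc1 i; rewrite il c1i.
case/andP=> _ /eqP cj; rewrite tensor_map_conjm conjmM tens_mul.
congr (E c (conjm (tens _) X)); apply: functional_extensionality_dep => i.
rewrite inE; have [->|ik] := eqVneq i k.
  by rewrite (negbTE kl) mul1mx c1k cj.
by rewrite mulmx1.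
Qed.

Lemma locc_instrument S T (J : 'I_m -> finType)
    (K : forall i, J i -> op R (S i))
    (E : joint J -> op R (joint S) -> op R (joint T)) :
  (forall i, \sum_j (K i j)^t* *m K i j = 1%:M) -> (forall c, locc (E c)) ->
  inhabited (joint J) ->
  locc (fun X => \sum_(c : joint J) E c (conjm (tens (fun i => K i (c i))) X)).
Proof.
move=> K1 E_locc [c0].
have := locc_instrument_seq K1 E_locc c0 (enum_uniq 'I_m).
set L := (fun X => _); set L' := (fun X => _); suff -> : L = L' by [].
apply/funext => X; rewrite /L /L'; apply: eq_big => [c|c _].
  by apply/forallP => i; rewrite mem_enum.
congr (E c (conjm (tens _) X)); apply: functional_extensionality_dep => i.
by rewrite mem_enum.
Qed.

End Locc.

(** * Tensor powers and measurement of one copy *)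

Section LocalPower.
Variables (R : realType) (n : nat) (Q : finType).
Local Notation C := (complex R).

Definition lpower (X : op R Q) : op R {ffun 'I_n -> Q} :=
  mkop (fun x y : {ffun 'I_n -> Q} => \prod_l ent X (x l) (y l)).

Lemma lpower_unitary (X : op R Q) :
  X \is unitarymx -> lpower X \is unitarymx.
Proof.
move=> /unitarymxP XU; apply/unitarymxP; apply: ent_inj => x y.
rewrite ent_mul ent1.
transitivity (\sum_(z : {ffun 'I_n -> Q}) \prod_l
    (ent X (x l) (z l) * ent (X^t*) (z l) (y l))).
  apply: eq_bigr => z _; rewrite ent_adj !ent_mkop rmorph_prod -big_split.
  by apply: eq_bigr => l _; rewrite ent_adj.
rewrite -(bigA_distr_bigA (fun l q => ent X (x l) q * ent (X^t*) q (y l))) /=.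
under eq_bigr do rewrite -ent_mul XU ent1.
have [->|xy] := eqVneq x y; first by rewrite big1 // => l _; rewrite eqxx.
have [l xyl] : exists l, x l != y l.
  apply/existsP; apply: contraR xy; rewrite negb_exists => /forallP xy.
  by apply/eqP/ffunP => l; apply/eqP; move: (xy l); rewrite negbK.
by rewrite (bigD1 l) //= (negbTE xyl) mul0r.
Qed.

End LocalPower.

Section Power.
Variables (R : realType) (m : nat) (A : 'I_m -> finType).
Local Notation C := (complex R).

(** Regroups [n] joint labels by party, so that a sum over the basis of [n] copies becomes a sum
    over [n] independent joint labels. *)
Definition untwist n (z : {ffun 'I_n -> joint A}) : joint (copies n A) :=
  [ffun i => [ffun l => z l i]].

Lemma copy_untwist n (z : {ffun 'I_n -> joint A}) l : copy (untwist z) l = z l.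
Proof. by apply/ffunP => i; rewrite !ffunE. Qed.

Lemma untwist_bij n : bijective (@untwist n).
Proof.
exists (fun x => [ffun l => copy x l]) => [z|x].
  by apply/ffunP => l; rewrite ffunE copy_untwist.
by apply/ffunP => i; apply/ffunP => l; rewrite !ffunE.
Qed.

Lemma powerM n (X Y : op R (joint A)) :
  power n (X *m Y) = power n X *m power n Y.
Proof.
apply: ent_inj => x y; rewrite ent_mul ent_mkop.
under eq_bigr do rewrite ent_mul.
rewrite bigA_distr_bigA (reindex (@untwist n)) /=; last first.
  exact/onW_bij/untwist_bij.
apply: eq_bigr => z _; rewrite !ent_mkop -big_split.
by apply: eq_bigr => l _; rewrite copy_untwist.
Qed.

Lemma power_adj n (X : op R (joint A)) : power n (X^t*) = (power n X)^t*.
Proof.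
apply: ent_inj => x y; rewrite ent_adj !ent_mkop rmorph_prod.
by apply: eq_bigr => l _; rewrite ent_adj.
Qed.

Lemma powerZ n (c : C) (X : op R (joint A)) :
  power n (c *: X) = c ^+ n *: power n X.
Proof.
apply: ent_inj => x y; rewrite entZ !ent_mkop.
under eq_bigr do rewrite entZ.
by rewrite big_split /= prodr_const card_ord.
Qed.

Lemma power_conjm n (K X : op R (joint A)) :
  power n (conjm K X) = conjm (power n K) (power n X).
Proof. by rewrite /conjm !powerM power_adj. Qed.

Lemma power_tens n (u : forall i, op R (A i)) :
  power n (tens u) = tens (fun i => lpower n (u i)) :> op R (joint (copies n A)).
Proof.
apply: ent_inj => x y; rewrite ent_mkop ent_mkrect.
under eq_bigr do rewrite ent_mkrect.
rewrite exchange_big /=; apply: eq_bigr => i _; rewrite ent_mkop.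
by apply: eq_bigr => l _; rewrite !ffunE.
Qed.

Lemma power_unitary n (X : op R (joint A)) :
  local_unitary X -> power n X \is unitarymx.
Proof.
move=> [u [uU ->]]; rewrite (power_tens n u); apply: tens_unitary => i.
exact: lpower_unitary.
Qed.

Lemma locc_power n (X : op R (joint A)) : 'I_m ->
  local_unitary X -> locc (conjm (power n X)).
Proof.
move=> k0 [u [uU ->]]; rewrite (power_tens n u).
by apply: (locc_conj_unitary k0) => i; apply: lpower_unitary.
Qed.

Lemma mxtrace_power n (X : op R (joint A)) : \tr (power n X) = (\tr X) ^+ n.
Proof.
rewrite mxtrace_ent (reindex (@untwist n)); last exact/onW_bij/untwist_bij.
rewrite mxtrace_ent -[n in RHS]card_ord -prodr_const bigA_distr_bigA.
apply: eq_bigr => z _; rewrite ent_mkop.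
by apply: eq_bigr => l _; rewrite copy_untwist.
Qed.

Definition lcons n (Q : finType) (a : Q) (f : {ffun 'I_n -> Q}) :
    {ffun 'I_n.+1 -> Q} :=
  [ffun l => if unlift ord0 l is Some l' then f l' else a].

Definition ltail n (Q : finType) (f : {ffun 'I_n.+1 -> Q}) : {ffun 'I_n -> Q} :=
  [ffun l => f (lift ord0 l)].

Lemma lcons0 n (Q : finType) (a : Q) (f : {ffun 'I_n -> Q}) :
  lcons a f ord0 = a.
Proof. by rewrite ffunE unlift_none. Qed.

Lemma lconsS n (Q : finType) (a : Q) (f : {ffun 'I_n -> Q}) l :
  lcons a f (lift ord0 l) = f l.
Proof. by rewrite ffunE liftK. Qed.

Lemma ltail_lcons n (Q : finType) (a : Q) (f : {ffun 'I_n -> Q}) :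
  ltail (lcons a f) = f.
Proof. by apply/ffunP => l; rewrite ffunE lconsS. Qed.

Lemma lcons_ltail n (Q : finType) (f : {ffun 'I_n.+1 -> Q}) :
  lcons (f ord0) (ltail f) = f.
Proof.
by apply/ffunP => l; rewrite ffunE; case: unliftP => [j ->|->]; rewrite ?ffunE.
Qed.

Definition pcons n (z : joint A * joint (copies n A)) : joint (copies n.+1 A) :=
  [ffun i => lcons (z.1 i) (z.2 i)].

Lemma pcons_bij n : bijective (@pcons n).
Proof.
exists (fun x => (copy x ord0, [ffun i => ltail (x i)] : joint (copies n A))).
  move=> [x0 x]; congr (_, _); apply/ffunP => i; rewrite !ffunE /=.
    by rewrite unlift_none.
  by rewrite ltail_lcons.
by move=> x; apply/ffunP => i; rewrite !ffunE /= lcons_ltail.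
Qed.

Lemma ent_powerS n (X : op R (joint A)) z z' :
  ent (power n.+1 X) (pcons z) (pcons z') =
  ent X z.1 z'.1 * ent (power n X) z.2 z'.2.
Proof.
have c0 (y : joint A * joint (copies n A)) : copy (pcons y) ord0 = y.1.
  by apply/ffunP => i; rewrite !ffunE unlift_none.
have cS (y : joint A * joint (copies n A)) l :
    copy (pcons y) (lift ord0 l) = copy y.2 l.
  by apply/ffunP => i; rewrite !ffunE liftK.
rewrite !ent_mkop big_ord_recl !c0; congr (_ * _).
by apply: eq_bigr => l _; rewrite !cS.
Qed.

(* <v| on the first copy, the identity on the others. *)
Definition bra n (Q : finType) (v : Q -> C) :
    'M[C]_(#|({ffun 'I_n -> Q} : finType)|, #|({ffun 'I_n.+1 -> Q} : finType)|) :=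
  mkrect (fun (s : {ffun 'I_n -> Q}) (x : {ffun 'I_n.+1 -> Q}) =>
    (s == ltail x)%:R * (v (x ord0))^*).

Lemma bra_ket n (Q : finType) (u v : Q -> C) :
  bra n u *m (bra n v)^t* = (\sum_a (u a)^* * v a) *: 1%:M.
Proof.
apply: ent_inj => s t; rewrite ent_mul entZ ent1.
rewrite (reindex (fun z : Q * {ffun 'I_n -> Q} => lcons z.1 z.2)) /=; last first.
  apply: onW_bij.
  exists (fun f : {ffun 'I_n.+1 -> Q} => (f ord0, ltail f)) => [[a f]|f] /=.
    by rewrite lcons0 ltail_lcons.
  by rewrite lcons_ltail.
rewrite -(pair_bigA _ (fun a f => ent (bra n u) s (lcons a f) *
  ent ((bra n v)^t*) (lcons a f) t)) /= mulr_suml.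
apply: eq_bigr => a _; rewrite (bigD1 s) //= big1 ?addr0 => [|f /negbTE fs].
  rewrite ent_adj !ent_mkrect ltail_lcons lcons0 eqxx mul1r rmorphM rmorph_nat.
  by rewrite /= conjCK eq_sym mulrCA mulrA mulrC; ring.
by rewrite ent_mkrect ltail_lcons eq_sym fs !mul0r.
Qed.

Lemma bra_resolution n (Q J : finType) (v : J -> Q -> C) :
  (forall a b, \sum_j v j a * (v j b)^* = (a == b)%:R) ->
  \sum_j (bra n (v j))^t* *m bra n (v j) = 1%:M.
Proof.
move=> v1; apply: ent_inj => x y; rewrite ent_sum ent1.
transitivity (\sum_j (ltail x == ltail y)%:R * (v j (x ord0) * (v j (y ord0))^*)).
  apply: eq_bigr => j _; rewrite ent_mul (bigD1 (ltail x)) //= big1 ?addr0.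
    by rewrite ent_adj !ent_mkrect eqxx mul1r conjCK; ring.
  by move=> s /negbTE sx; rewrite ent_adj ent_mkrect sx mul0r rmorph0 mul0r.
rewrite -mulr_sumr v1 -natrM mulnb; congr (nat_of_bool _)%:R.
apply/andP/eqP => [[/eqP xy /eqP xy0]|-> //].
by rewrite -(lcons_ltail x) xy xy0 lcons_ltail.
Qed.

Lemma delta_resolution (Q : finType) (a b : Q) :
  \sum_(j : Q) (a == j)%:R * ((b == j)%:R)^* = (a == b)%:R :> C.
Proof.
under eq_bigr do rewrite rmorph_nat eq_sym [b == _]eq_sym.
by rewrite (sum_delta (fun j => (j == b)%:R)).
Qed.

Definition ptrace n (Q : finType) :
    op R {ffun 'I_n.+1 -> Q} -> op R {ffun 'I_n -> Q} :=
  kraus (fun b : Q => bra n (fun a => (a == b)%:R)).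

Lemma ptrace_tp n (Q : finType) : trace_preserving (@ptrace n Q).
Proof.
move=> X; rewrite kraus_trace bra_resolution ?mul1mx //.
exact: delta_resolution.
Qed.

Section Measurement.
Variables (J : 'I_m -> finType) (v : forall i, J i -> A i -> C).
Arguments v : clear implicits.
Hypothesis v1 : forall i a b, \sum_j v i j a * (v i j b)^* = (a == b)%:R.

(** The unnormalized branch of outcome [c], with the measured copy consumed. *)
Definition measure n (c : joint J) : op R (joint (copies n.+1 A)) ->
    op R (joint (copies n A)) :=
  conjm (tens (fun i => bra n (v i (c i)))).

Lemma locc_measure n (T : 'I_m -> finType)
    (E : joint J -> op R (joint (copies n A)) -> op R (joint T)) :
  'I_m -> inhabited (joint A) -> inhabited (joint J) ->
  (forall c, locc (E c)) ->
  locc (fun X => \sum_(c : joint J) E c (measure c X)).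
Proof.
move=> k0 [a] c0 E_locc; pose e i (b x : A i) : C := (x == b)%:R.
(* Party i replaces its measured copy by |a i>, so that all rounds keep the same
   spaces, and traces it out after the last round. *)
pose K i (j : J i) : op R (copies n.+1 A i) :=
  (bra n (e i (a i)))^t* *m bra n (v i j).
have braK i b (j : J i) : bra n (e i b) *m K i j = (b == a i)%:R *: bra n (v i j).
  rewrite mulmxA bra_ket -scalemxAl mul1mx; congr (_ *: _).
  by under eq_bigr do rewrite rmorph_nat; rewrite (sum_delta (fun x => (x == a i)%:R)).
have K1 i : \sum_j (K i j)^t* *m K i j = 1%:M.
  rewrite -(bra_resolution n (@v1 i)); apply: eq_bigr => j _.
  rewrite {2}/K mulmxA /K adjmxM trmxCK -[_ *m bra n (e i (a i)) *m _]mulmxA.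
  rewrite bra_ket; under eq_bigr do rewrite rmorph_nat.
  by rewrite (sum_delta (fun x => (x == a i)%:R)) eqxx scale1r mulmx1.
have P_locc : locc (tensor_map (fun i => @ptrace n (A i))).
  apply: (locc_local k0) => i; first exact: kraus_cp.
  exact: ptrace_tp.
have := locc_instrument K1 (fun c => locc_comp P_locc (E_locc c)) c0.
set L := (fun X => _); set L' := (fun X => _); suff -> : L = L' by [].
apply/funext => X; apply: eq_bigr => c _; congr (E c _).
(* In the final partial trace only the Kraus term [b = a] survives, since each party has left |a i>
   in the measured slot. *)
rewrite tensor_map_kraus /kraus (bigD1 a) //= big1 ?addr0 => [|b ba].
  rewrite -/(conjm _ _) conjmM tens_mul; congr (conjm (tens _) X).
  by apply: functional_extensionality_dep => i; rewrite braK eqxx scale1r.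
rewrite -/(conjm _ _) conjmM tens_mul.
have [i bai] : exists i, b i != a i.
  apply/existsP; apply: contraR ba; rewrite negb_exists => /forallP ba.
  by apply/eqP/ffunP => i; apply/eqP; move: (ba i); rewrite negbK.
have -> : (fun i => bra n (e i (b i)) *m K i (c i)) =
    (fun i => (b i == a i)%:R *: bra n (v i (c i))).
  by apply: functional_extensionality_dep => i'; rewrite braK.
by rewrite tensZ (bigD1 i) //= (negbTE bai) mul0r conjmZ mul0r scale0r.
Qed.

Definition product_bra (c : joint J) : 'M[C]_(#|(unit : finType)|, #|(joint A : finType)|) :=
  mkrect (fun (_ : unit) (x : joint A) => \prod_i (v i (c i) (x i))^*).

Definition prob (X : op R (joint A)) (c : joint J) : C :=
  ent (conjm (product_bra c) X) tt tt.

Lemma probE X c : prob X c = \sum_(p : joint A * joint A) ent X p.1 p.2 *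
  \prod_i ((v i (c i) (p.1 i))^* * v i (c i) (p.2 i)).
Proof.
rewrite /prob ent_conj; apply: eq_bigr => -[x y] _ /=.
rewrite !ent_mkrect rmorph_prod -big_split /=; congr (_ * _).
by apply: eq_bigr => i _; rewrite conjCK.
Qed.

Lemma prob_ge0 X c : psd X -> 0 <= prob X c.
Proof. by move=> X0; apply/psd_entry_ge0/psd_conj. Qed.

Lemma prob_sum X : \sum_c prob X c = \tr X.
Proof.
under eq_bigr do rewrite probE.
rewrite exchange_big mxtrace_joint; apply: eq_bigr => -[x y] _ /=.
rewrite -mulr_sumr -(bigA_distr_dffun
  (fun i j => (v i j (x i))^* * v i j (y i))) /=; congr (_ * _).
apply: eq_bigr => i _; rewrite mxtrace_ketbra eq_sym -v1.
by apply: eq_bigr => j _; rewrite mulrC.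
Qed.

(** The copies are independent, so measuring one leaves the others intact up to the scalar
    probability. This turns a sequence of measurements into a classical recursion over records. *)
Lemma measure_power n X c :
  measure c (power n.+1 X) = prob X c *: power n X.
Proof.
apply: ent_inj => s t; rewrite entZ probE /measure ent_conj.
pose f (z : joint (copies n.+1 A)) (s : joint (copies n A)) : C :=
  ent (tens (fun i => bra n (v i (c i)))) s z.
have fE x0 x s' : f (pcons (x0, x)) s' =
    (x == s')%:R * \prod_i (v i (c i) (x0 i))^*.
  rewrite /f ent_mkrect.
  have E i : ent (bra n (v i (c i))) (s' i) (pcons (x0, x) i) =
     (s' i == x i)%:R * (v i (c i) (x0 i))^*.
    by rewrite ent_mkrect ffunE ltail_lcons lcons0.
  under eq_bigr do rewrite E.
  rewrite big_split /=; congr (_ * _).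
  have [->|xs] := eqVneq x s'; first by rewrite big1 // => i _; rewrite eqxx.
  have [i xsi] : exists i, s' i != x i.
    apply/existsP; apply: contraR xs; rewrite negb_exists => /forallP xs.
    by apply/eqP/ffunP => i; apply/eqP; move: (xs i); rewrite negbK => /eqP ->.
  by rewrite (bigD1 i) //= (negbTE xsi) mul0r.
rewrite -(pair_bigA _ (fun z z' => ent (power n.+1 X) z z' * (f z s * (f z' t)^*))) /=.
rewrite (reindex (@pcons n)) /=; last exact/onW_bij/pcons_bij.
under eq_bigr => z _.
  rewrite (reindex (@pcons n)) /=; last exact/onW_bij/pcons_bij.
  over.
rewrite -(pair_bigA _ (fun x0 x => \sum_(z' : joint A * joint (copies n A))
  ent (power n.+1 X) (pcons (x0, x)) (pcons z') *
  (f (pcons (x0, x)) s * (f (pcons z') t)^*))) /=.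
rewrite -(pair_bigA _ (fun x0 y0 => ent X x0 y0 *
  \prod_i ((v i (c i) (x0 i))^* * v i (c i) (y0 i)))) /= mulr_suml.
apply: eq_bigr => x0 _; rewrite (bigD1 s) //= [X in _ + X]big1 ?addr0; last first.
  by move=> x /negbTE xs; rewrite big1 // => z' _; rewrite fE xs !(mul0r, mulr0).
rewrite -(pair_bigA _ (fun y0 y => ent (power n.+1 X) (pcons (x0, s)) (pcons (y0, y)) *
  (f (pcons (x0, s)) s * (f (pcons (y0, y)) t)^*))) /= mulr_suml.
apply: eq_bigr => y0 _; rewrite (bigD1 t) //= [X in _ + X]big1 ?addr0; last first.
  by move=> y /negbTE yt; rewrite [f (pcons (y0, y)) t]fE yt mul0r rmorph0 !mulr0.
have -> : f (pcons (y0, t)) t = (\prod_i v i (c i) (y0 i))^*.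
  by rewrite fE eqxx mul1r rmorph_prod.
rewrite fE ent_powerS /= eqxx mul1r conjCK big_split /=; ring.
Qed.

End Measurement.
End Power.

(** * Estimation by informationally complete measurements *)

Section States.
Variable R : realType.
Local Notation C := (complex R).

Lemma psd_factor n (X : 'M[C]_n) : psd X -> exists K : 'M[C]_n, X = K *m K^t*.
Proof.
move=> /psd_spectral[V _ [d d0 ->]].
exists (V^t* *m diag_mx (\row_i sqrtC (d 0 i))).
rewrite adjmxM trmxCK adjmx_diag !mulmxA -[_ *m diag_mx _ *m diag_mx _]mulmxA.
rewrite mulmx_diag; congr (_ *m diag_mx _ *m _); apply/rowP=> i; rewrite !mxE.
have /CrealP -> : sqrtC (d 0 i) \is Num.real by rewrite ger0_real // sqrtC_ge0.
by rewrite -expr2 sqrtCK.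
Qed.

Lemma density_trnorm n (X : 'M[C]_n) : density X -> trnorm X <= 1.
Proof. by move=> [X0 X1]; rewrite -lecR -[1%:C%C]X1; apply: trnorm_psd. Qed.

Lemma density_conj n (K X : 'M[C]_n) :
  K \is unitarymx -> density X -> density (conjm K X).
Proof.
move=> KU [X0 X1]; split; first exact: psd_conj.
by rewrite conjm_trace unitarymxPl // mul1mx.
Qed.

Lemma density_power m (A : 'I_m -> finType) n (X : op R (joint A)) :
  density X -> density (power n X).
Proof.
move=> [/psd_factor[K XE] X1]; split; last by rewrite mxtrace_power X1 expr1n.
by rewrite XE powerM power_adj; apply: psd_gram.
Qed.

Lemma density_locc m (S T : 'I_m -> finType)
    (L : op R (joint S) -> op R (joint T)) X :
  locc L -> density X -> density (L X).
Proof.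
move=> /locc_channel[_ L_psd L_tr] [X0 X1]; split; first exact: L_psd.
by rewrite L_tr.
Qed.

Lemma density_inhabited m (A : 'I_m -> finType) (X : op R (joint A)) :
  density X -> inhabited (joint A).
Proof.
move=> [_ X1]; apply: contrapT => A0; have /eqP := X1.
rewrite mxtrace_ent big1 => [|x _]; first by rewrite eq_sym oner_eq0.
by case: A0; apply: inhabits x.
Qed.

End States.

(** * A local informationally complete measurement *)

Section Tomography.
Variables (R : realType) (m : nat) (A : 'I_m -> finType).
Local Notation C := (complex R).

Definition ic_index (i : 'I_m) : finType := ((A i * A i) * 'I_4)%type.

(** The sum over the four phases gives 4, and each of the two basis vectors of a pair then gives
    [#|A i|] times the identity, hence [8 * #|A i|]. *)
Definition ic_scale (i : 'I_m) : C := ((8 * #|A i|)%N%:R)^-1.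

(* Polarization: for k < 4, the vectors |a> + i^k |b> resolve a multiple of the
   identity, and the weights i^k isolate one matrix unit. *)
Definition ic_vec (i : 'I_m) (j : ic_index i) (x : A i) : C :=
  sqrtC (ic_scale i) * ((x == j.1.1)%:R + 'i ^+ j.2 * (x == j.1.2)%:R).

Lemma ic_vecE i (j : ic_index i) x y : ic_vec j x * (ic_vec j y)^* =
  ic_scale i * (((x == j.1.1)%:R + 'i ^+ j.2 * (x == j.1.2)%:R) *
                ((y == j.1.1)%:R + (- 'i) ^+ j.2 * (y == j.1.2)%:R)).
Proof.
have c0 : 0 <= ic_scale i by rewrite invr_ge0 ler0n.
have /CrealP cR : sqrtC (ic_scale i) \is Num.real.
  by rewrite ger0_real // sqrtC_ge0.
rewrite /ic_vec !rmorphM /= cR rmorphD rmorphM /= rmorphXn /= conjCi.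
by rewrite !rmorph_nat mulrACA -expr2 sqrtCK.
Qed.

Lemma sum_ord4 (f : nat -> C) : \sum_(k < 4) f k = f 0%N + f 1%N + f 2%N + f 3%N.
Proof. by rewrite !big_ord_recr big_ord0 /= add0r. Qed.

Lemma ic_phase_sum (a b c d : C) :
  \sum_(k < 4) (a + 'i ^+ k * b) * (c + (- 'i) ^+ k * d) = 4 * (a * c + b * d).
Proof.
rewrite (sum_ord4 (fun k => (a + 'i ^+ k * b) * (c + (- 'i) ^+ k * d))).
have i2 := @sqrCi C; ring: i2.
Qed.

(** The weight ['i ^+ k] makes the phase of [a * d] trivial and those of the other three products
    nontrivial characters of Z/4, which sum to zero. *)
Lemma ic_phase_invert (a b c d : C) :
  \sum_(k < 4) 'i ^+ k * ((a + 'i ^+ k * b) * (c + (- 'i) ^+ k * d)) = 4 * (a * d).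
Proof.
rewrite (sum_ord4 (fun k => 'i ^+ k * ((a + 'i ^+ k * b) * (c + (- 'i) ^+ k * d)))).
have i2 := @sqrCi C; ring: i2.
Qed.

Lemma ic_scale_cancel (F : numFieldType) (d x : F) : d != 0 ->
  (8 * d)^-1 * (4 * (x * d + x * d)) = x.
Proof. by move=> d0; field. Qed.

Lemma ic_resolution i a b :
  \sum_(j : ic_index i) ic_vec j a * (ic_vec j b)^* = (a == b)%:R.
Proof.
under eq_bigr do rewrite ic_vecE.
rewrite -mulr_sumr.
rewrite -(pair_bigA _ (fun (p : A i * A i) (k : 'I_4) =>
  (((a == p.1)%:R + 'i ^+ k * (a == p.2)%:R) *
                ((b == p.1)%:R + (- 'i) ^+ k * (b == p.2)%:R)))) /=.
under eq_bigr do rewrite ic_phase_sum.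
rewrite -(pair_bigA _ (fun p q : A i => 4 * ((a == p)%:R * (b == p)%:R +
  (a == q)%:R * (b == q)%:R))) /=.
have s x y : \sum_(z : A i) (x == z)%:R * (y == z)%:R = (x == y)%:R :> C.
  under eq_bigr do rewrite eq_sym.
  by rewrite (sum_delta (fun z => (y == z)%:R)) eq_sym.
under eq_bigr do rewrite -mulr_sumr big_split /= s sumr_const.
rewrite -mulr_sumr big_split /= sumrMnl s sumr_const cardT -cardE.
have d0 : (#|A i|)%:R != 0 :> C.
  by rewrite pnatr_eq0 -lt0n; apply/card_gt0P; exists a.
rewrite /ic_scale natrM -[(a == b)%:R *+ #|A i|]mulr_natr; exact: ic_scale_cancel.
Qed.

Lemma ic_complete (X Y : op R (joint A)) :
  (forall c, prob ic_vec X c = prob ic_vec Y c) -> X = Y.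
Proof.
move=> XY.
(* An entry is recovered by applying the phase sum at every party at once; the constants
   [ic_scale i * 4] are nonzero and are cancelled at the end. *)
have rec (Z : op R (joint A)) (q p : joint A) :
    \sum_(k : {ffun 'I_m -> 'I_4}) \prod_i 'i ^+ k i *
      prob ic_vec Z [ffun i => (p i, q i, k i)] =
    ent Z q p * \prod_i (ic_scale i * 4).
  transitivity (\sum_(k : {ffun 'I_m -> 'I_4}) \sum_(z : joint A * joint A)
      ent Z z.1 z.2 * \prod_i ('i ^+ k i * (ic_vec ((p i, q i, k i) : ic_index i) (z.2 i) *
        (ic_vec ((p i, q i, k i) : ic_index i) (z.1 i))^*))).
    apply: eq_bigr => k _; rewrite probE mulr_sumr; apply: eq_bigr => z _.
    rewrite mulrCA -big_split /=; congr (_ * _); apply: eq_bigr => i _.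
    by rewrite ffunE; congr (_ * _); apply: mulrC.
  rewrite exchange_big /= (bigD1 (q, p)) //= [X in _ + X]big1 ?addr0.
    rewrite -mulr_sumr -(bigA_distr_bigA (fun i (k : 'I_4) => 'i ^+ k *
      (ic_vec ((p i, q i, k) : ic_index i) (p i) *
        (ic_vec ((p i, q i, k) : ic_index i) (q i))^*))) /=.
    congr (_ * _); apply: eq_bigr => i _.
    under eq_bigr do rewrite ic_vecE mulrCA /=.
    by rewrite -mulr_sumr ic_phase_invert !eqxx !mulr1.
  move=> [x y] xy.
  rewrite -mulr_sumr -(bigA_distr_bigA (fun i (k : 'I_4) => 'i ^+ k *
    (ic_vec ((p i, q i, k) : ic_index i) (y i) *
      (ic_vec ((p i, q i, k) : ic_index i) (x i))^*))) /=.
  have [i xyi] : exists i, ~~ ((y i == p i) && (x i == q i)).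
    apply/existsP; apply: contraR xy; rewrite negb_exists => /forallP xy.
    apply/eqP; congr (_, _); apply/ffunP => i; apply/eqP;
    by move: (xy i); rewrite negbK => /andP[].
  rewrite (bigD1 i) //=.
  under [X in _ * (X * _)]eq_bigr do rewrite ic_vecE mulrCA /=.
  rewrite -mulr_sumr ic_phase_invert -natrM mulnb (negbTE xyi).
  by rewrite !(mulr0, mul0r).
apply: ent_inj => q p.
have s0 : \prod_i (ic_scale i * 4) != 0 :> C.
  apply/prodf_neq0 => i _; rewrite mulf_neq0 ?pnatr_eq0 // invr_eq0.
  rewrite pnatr_eq0 muln_eq0 /= -lt0n; apply/card_gt0P; by exists (q i).
apply: (mulIf s0); rewrite -!rec.
by apply: eq_bigr => k _; rewrite XY.
Qed.

End Tomography.

(** * Telling finitely many distributions apart by counting outcomes *)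

Section Counting.
Variables (F : realFieldType) (X : finType).
Implicit Types (q : X -> F) (c : seq X).

Definition deviation q c x : F := (count_mem x c)%:R - (size c)%:R * q x.

Definition potential q c : F := \sum_x deviation q c x ^+ 2.

Lemma potential_ge0 q c : 0 <= potential q c.
Proof. by apply: sumr_ge0 => x _; apply: sqr_ge0. Qed.

Lemma potential_nil q : potential q [::] = 0.
Proof.
by apply: big1 => x _; rewrite /deviation mul0r subrr expr0n.
Qed.

(** The increment [(x == y)%:R - q y] of a deviation has mean zero, so cross terms vanish, and its
    variance [q y * (1 - q y)] is at most [q y]; these sum to 1 over [y]. *)
Lemma potential_step q c : \sum_x q x = 1 -> (forall x, 0 <= q x) ->
  \sum_x q x * potential q (x :: c) <= potential q c + 1.
Proof.
move=> q1 q0; under eq_bigr do rewrite mulr_sumr.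
rewrite exchange_big /= -{1}q1 -big_split /=; apply: ler_sum => y _.
set D := deviation q c y; set b := q y.
have devE x : deviation q (x :: c) y = D + (x == y)%:R - b.
  by rewrite /D /deviation /= natrD [(size c).+1%:R]mulrSr -/b; ring.
have -> : \sum_x q x * deviation q (x :: c) y ^+ 2 =
    (D - b) ^+ 2 * \sum_x q x + (2 * (D - b) + 1) * \sum_x (x == y)%:R * q x.
  rewrite !mulr_sumr -big_split /=; apply: eq_bigr => x _; rewrite devE.
  by case: (x == y) => /=; ring.
rewrite q1 (bigD1 y) //= eqxx big1 => [|x /negbTE ->]; last by rewrite mul0r.
rewrite -/b mulr1 addr0 mulr1n mul1r -subr_ge0.
have -> : D ^+ 2 + b - ((D - b) ^+ 2 + (2 * (D - b) + 1) * b) = b ^+ 2 by ring.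
exact: sqr_ge0.
Qed.

Variables (G : finType) (p : G -> X -> F).

Definition gap g h : F := \sum_x (p g x - p h x) ^+ 2.

(* The terms with [gap = 0] contribute [0^-1 = 0]. *)
Definition inv_gap : F := 1 + \sum_(gh : G * G) (gap gh.1 gh.2)^-1.

Lemma gap_ge0 g h : 0 <= gap g h.
Proof. by apply: sumr_ge0 => x _; apply: sqr_ge0. Qed.

Lemma inv_gap_ge0 : 0 <= inv_gap.
Proof.
by rewrite addr_ge0 // sumr_ge0 // => gh _; rewrite invr_ge0 gap_ge0.
Qed.

(** There are only finitely many pairs, so the sum of the inverse gaps dominates the inverse of each
    nonzero one. *)
Lemma inv_gapP g h x : p g x != p h x -> 1 <= inv_gap * gap g h.
Proof.
move=> gh; have gap_gt0 : 0 < gap g h.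
  rewrite lt_def gap_ge0 andbT; apply: contraNneq gh => gap0.
  move/psumr_eq0P: gap0 => /(_ (fun x _ => sqr_ge0 _) x isT)/eqP.
  by rewrite sqrf_eq0 subr_eq0.
rewrite -ler_pdivrMr // div1r /inv_gap (bigD1 (g, h)) //= addrCA lerDl.
by rewrite addr_ge0 // sumr_ge0 // => gh' _; rewrite invr_ge0 gap_ge0.
Qed.

Definition likely c g := 4 * inv_gap * potential (p g) c < (size c)%:R ^+ 2.

(** As [(u - v) ^ 2 <= 2 * u ^ 2 + 2 * v ^ 2], two likely elements with distinct distributions would
    satisfy [inv_gap * N ^ 2 * gap < N ^ 2], against [inv_gapP]. The factor 4 in [likely] grants
    each of the two half of this bound. *)
Lemma likely_unique c g h x : likely c g -> likely c h -> p g x = p h x.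
Proof.
rewrite /likely => cg ch; apply/eqP; apply: contraT => /inv_gapP gap1.
have S0 := inv_gap_ge0; set N : F := (size c)%:R in cg ch.
have key : N ^+ 2 * gap g h <= 2 * potential (p g) c + 2 * potential (p h) c.
  rewrite /gap /potential !mulr_sumr -big_split /=; apply: ler_sum => y _.
  rewrite -subr_ge0 /deviation -/N.
  have -> d a b : 2 * (d - N * a) ^+ 2 + 2 * (d - N * b) ^+ 2 -
      N ^+ 2 * (a - b) ^+ 2 = (d - N * a + (d - N * b)) ^+ 2 by ring.
  exact: sqr_ge0.
have := ler_wpM2l S0 key; have := ler_wpM2l (sqr_ge0 N) gap1.
have -> : N ^+ 2 * (inv_gap * gap g h) = inv_gap * (N ^+ 2 * gap g h) by ring.
by lra.
Qed.

Definition guess g0 c : G := odflt g0 [pick g | likely c g].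

Lemma guessP g0 c h x : likely c h -> p (guess g0 c) x = p h x.
Proof.
move=> ch; rewrite /guess; case: pickP => [g cg|/(_ h)]; last by rewrite ch.
exact: (likely_unique x cg ch).
Qed.

End Counting.

(** * Measuring copies one by one within a protocol *)

Section Sampling.
Variables (R : realType) (m : nat) (A : 'I_m -> finType).
Local Notation C := (complex R).
Variable k0 : 'I_m.
Hypothesis A_inh : inhabited (joint A).

Local Notation outcome := (joint (@ic_index m A)).
Local Notation measure := (measure (@ic_vec R m A)).

Definition ic_prob (X : op R (joint A)) (x : outcome) : R :=
  complex.Re (prob (@ic_vec R m A) X x).

Lemma ic_probE X x : psd X -> prob (@ic_vec R m A) X x = (ic_prob X x)%:C%C.
Proof. by move=> X0; rewrite RRe_real // ger0_real // prob_ge0. Qed.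

Lemma ic_prob_ge0 X x : psd X -> 0 <= ic_prob X x.
Proof. by move=> X0; rewrite -ler0c -ic_probE // prob_ge0. Qed.

Lemma ic_prob_inj X Y : psd X -> psd Y -> ic_prob X =1 ic_prob Y -> X = Y.
Proof.
by move=> X0 Y0 XY; apply: ic_complete => x; rewrite (ic_probE x X0) XY -ic_probE.
Qed.

Lemma ic_prob_sum X : density X -> \sum_x ic_prob X x = 1.
Proof.
move=> [X0 X1]; apply: (@complexI R); rewrite rmorph_sum /= -[RHS]X1.
rewrite -(prob_sum (@ic_resolution R m A) X).
by apply: eq_bigr => x _; rewrite ic_probE.
Qed.

(** The record [c] is an accumulator, latest outcome first. The copies to be measured come first in
    [s + n], so that the types of successive stages agree by computation. *)
Fixpoint protocol n (T : 'I_m -> finType)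
    (E : seq outcome -> op R (joint (copies n A)) -> op R (joint T))
    s (c : seq outcome) {struct s} :
    op R (joint (copies (s + n) A)) -> op R (joint T) :=
  match s with
  | 0 => E c
  | s'.+1 => fun X => \sum_x protocol E (x :: c) (measure (n := s' + n) x X)
  end.

Lemma locc_protocol n T E s c : (forall c, locc (E c)) ->
  locc (@protocol n T E s c).
Proof.
move=> E_locc; elim: s c => [|s IH] c //=.
have outcome_inh : inhabited outcome.
  by case: A_inh => a; apply: inhabits [ffun i => (a i, a i, ord0)].
exact: (locc_measure (@ic_resolution R m A) k0 A_inh outcome_inh
  (fun x => IH (x :: c))).
Qed.

Lemma protocol_power n T E s c X : density X -> (forall c, locc (E c)) ->
  @protocol n T E s.+1 c (power (s.+1 + n) X) =
  \sum_x (ic_prob X x)%:C%C *: protocol E (x :: c) (power (s + n) X).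
Proof.
move=> [X0 _] E_locc; apply: eq_bigr => x _.
have [L_lin _ _] := locc_channel (locc_protocol s (x :: c) E_locc).
by rewrite measure_power linearZ_of // ic_probE.
Qed.

(* The expected potential grows by at most one per measured copy, so a leaf
   error [a + b * potential] costs [b * s] over [s] copies; this replaces the
   law of large numbers. *)
Lemma protocol_error n T E (X : op R (joint A)) Z N (a b : R) :
  density X -> (forall c, locc (E c)) -> 0 <= b ->
  (forall c, size c = N ->
    trnorm (E c (power n X) - Z) <= a + b * potential (ic_prob X) c) ->
  forall s c, (size c + s)%N = N ->
  trnorm (@protocol n T E s c (power (s + n) X) - Z) <=
  a + b * (potential (ic_prob X) c + s%:R).
Proof.
move=> Xd E_locc b0 leaf; have p1 := ic_prob_sum Xd.
have p0 x : 0 <= ic_prob X x by apply: ic_prob_ge0; case: Xd.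
elim=> [|s IH] c sc.
  by rewrite addr0; apply: leaf; rewrite -sc addn0.
rewrite protocol_power //.
have -> : Z = \sum_x (ic_prob X x)%:C%C *: Z.
  by rewrite -scaler_suml -rmorph_sum p1 scale1r.
rewrite -sumrB; apply: le_trans (trnorm_sum _) _.
apply: (@le_trans _ _ (\sum_x ic_prob X x *
    (a + b * (potential (ic_prob X) (x :: c) + s%:R)))).
  apply: ler_sum => x _; rewrite -scalerBr.
  apply: le_trans (trnormZ _ (p0 x)) _; apply: ler_wpM2l => //.
  by apply: IH; rewrite /= -sc addSnnS.
have -> : \sum_x ic_prob X x * (a + b * (potential (ic_prob X) (x :: c) + s%:R)) =
    (a + b * s%:R) * (\sum_x ic_prob X x) +
    b * \sum_x ic_prob X x * potential (ic_prob X) (x :: c).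
  by rewrite !mulr_sumr -big_split; apply: eq_bigr => x _ /=; ring.
have := ler_wpM2l b0 (potential_step c p1 p0); rewrite p1.
by rewrite [s.+1%:R]mulrSr; lra.
Qed.

(** Discarding is measuring and ignoring the record: the probabilities sum to 1. *)
Lemma locc_discard s n : exists D : op R (joint (copies (s + n) A)) ->
    op R (joint (copies n A)),
  locc D /\ forall X, density X -> D (power (s + n) X) = power n X.
Proof.
pose E (c : seq outcome) (X : op R (joint (copies n A))) := X.
have E_locc c : locc (E c) by apply: locc_id.
exists (protocol E [::]); split; first exact: locc_protocol.
move=> X Xd; move: [::]; elim: s => [|s IH] c //.
rewrite protocol_power //; under eq_bigr do rewrite IH.
by rewrite -scaler_suml -rmorph_sum ic_prob_sum // scale1r.
Qed.

End Sampling.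

(** * Covariant protocols *)

Section Action.
Variables (R : realType) (G : finGroupType).
Local Notation C := (complex R).

(** The phase [w] meets its conjugate, so conjugation is a genuine group action although the
    representation is projective. *)
Lemma rep_conjmM n (V : G -> 'M[C]_n) g h X : proj_unitary_rep V ->
  conjm (V g) (conjm (V h) X) = conjm (V (g * h)%g) X.
Proof.
move=> [_ /(_ g h)[w w1 VE]].
by rewrite conjmM VE conjmZ -normCK w1 expr1n scale1r.
Qed.

Lemma conjm_unitaryK n (V X : 'M[C]_n) : V \is unitarymx ->
  conjm (V^t*) (conjm V X) = X.
Proof. by move=> VU; rewrite conjmM unitarymxPl // conjm1. Qed.

(** [V 1] may carry a phase, but conjugation by it is idempotent and invertible, hence the
    identity. *)
Lemma rep_conjm1 n (V : G -> 'M[C]_n) X : proj_unitary_rep V ->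
  conjm (V 1%g) X = X.
Proof.
move=> V_rep; have [VU _] := V_rep.
have := rep_conjmM 1 1 X V_rep; rewrite mulg1 => /(congr1 (conjm ((V 1%g)^t*))).
by rewrite !conjm_unitaryK.
Qed.

Lemma power_rep m (A : 'I_m -> finType) n (U : G -> op R (joint A)) :
  (forall g, local_unitary (U g)) -> proj_unitary_rep U ->
  proj_unitary_rep (fun g => power n (U g)).
Proof.
move=> U_local [_ U_mul]; split=> [g|g h]; first exact: power_unitary.
have [w w1 UE] := U_mul g h; exists (w ^+ n).
  by rewrite normrX w1 expr1n.
by rewrite -powerM UE powerZ.
Qed.

Lemma mem_Sym n (V : G -> 'M[C]_n) X g : (g \in Sym V X) = (conjm (V g) X == X).
Proof. by rewrite inE. Qed.

End Action.

Section Covariant.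
Variables (R : realType) (m : nat) (A B : 'I_m -> finType) (G : finGroupType).
Local Notation C := (complex R).
Variables (U : G -> op R (joint A)) (U' : G -> op R (joint B)).
Hypothesis U_rep : proj_unitary_rep U.
Hypothesis U'_rep : proj_unitary_rep U'.
Hypothesis U_local : forall g, local_unitary (U g).
Hypothesis U'_local : forall g, local_unitary (U' g).
Variable k0 : 'I_m.

Local Notation act n g := (conjm (power n (U g))).
Local Notation act' k g := (conjm (power k (U' g))).

(** The scalar is [1 / #|G|], the weight of the uniform distribution. *)
Definition twirl n k
    (P : op R (joint (copies n A)) -> op R (joint (copies k B)))
    (X : op R (joint (copies n A))) : op R (joint (copies k B)) :=
  \sum_(h : G) (\sum_(h : G) 1)^-1 *: act' k h^-1%g (P (act n h X)).

Lemma group_sum_neq0 : \sum_(h : G) 1 != 0 :> C.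
Proof.
rewrite (bigD1 1%g) //= gt_eqF // ltr_pwDl ?ltr01 //.
by apply: sumr_ge0 => *; apply: ler01.
Qed.

Lemma twirl_cov_LOCC n k P : locc P -> cov_LOCC U U' (@twirl n k P).
Proof.
move=> P_locc; split.
  apply: (locc_mix k0) => [h||h].
  - by rewrite invr_ge0 sumr_ge0 // => *; apply: ler01.
  - under eq_bigr do rewrite -[_^-1]mulr1.
    by rewrite -mulr_sumr mulVf // group_sum_neq0.
  apply: (locc_comp (locc_comp (locc_power n k0 (U_local h)) P_locc)).
  exact: locc_power.
move=> g X; rewrite -/(conjm _ _) -/(conjm _ (twirl P X)).
have lin : linear (act' k g).
  by move=> c Y Z; rewrite /conjm mulmxDr mulmxDl -scalemxAr -scalemxAl.
(* Replacing [h] by [h * g] on the right makes the inputs of [P] agree, and the output action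
   [g * (h * g)^-1] collapses to [h^-1]. *)
rewrite /twirl (linear_lincomb _ _ lin) [RHS](reindex_inj (mulIg g)) /=.
apply: eq_bigr => h _; congr (_ *: _).
rewrite (rep_conjmM h g X (power_rep n U_local U_rep)).
rewrite (rep_conjmM g _ _ (power_rep k U'_local U'_rep)).
by rewrite invMg mulKVg.
Qed.

Variables (rho : op R (joint A)) (sigma : op R (joint B)).
Hypothesis rho_state : density rho.
Hypothesis sigma_state : density sigma.

Local Notation rho_ g := (conjm (U g) rho).
Local Notation sigma_ g := (conjm (U' g) sigma).

(** Undoing [h] on the output carries [sigma_ h] back to [sigma], so the branch [h] may be judged
    against the rotated target. *)
Lemma twirl_error n k P (a : R) : 
  (forall h, trnorm (P (power n (rho_ h)) - power k (sigma_ h)) <= a) ->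
  trnorm (@twirl n k P (power n rho) - power k sigma) <= a.
Proof.
move=> Pa; pose p : R := (\sum_(h : G) 1)^-1.
have pE : (\sum_(h : G) 1)^-1 = p%:C%C.
  by rewrite /p fmorphV rmorph_sum /=.
have p1 : \sum_(h : G) p = 1.
  apply: (@complexI R); rewrite rmorph_sum /= -pE.
  under eq_bigr do rewrite -[_^-1]mulr1.
  by rewrite -mulr_sumr mulVf // group_sum_neq0.
have p0 : 0 <= p by rewrite invr_ge0 sumr_ge0 // => *; apply: ler01.
have -> : power k sigma = \sum_(h : G) p%:C%C *:
    act' k h^-1%g (power k (sigma_ h)).
  under eq_bigr do rewrite power_conjm
    (rep_conjmM _ _ _ (power_rep k U'_local U'_rep)) mulVg
    (rep_conjm1 _ (power_rep k U'_local U'_rep)).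
  by rewrite -scaler_suml -rmorph_sum p1 scale1r.
rewrite /twirl pE -sumrB; apply: le_trans (trnorm_sum _) _.
rewrite -[leRHS]mul1r -p1 mulr_suml; apply: ler_sum => h _.
rewrite -scalerBr; apply: le_trans (trnormZ _ p0) _; apply: ler_wpM2l => //.
rewrite /conjm -mulmxBl -mulmxBr.
apply: le_trans (trnorm_unitary _ _) _; first exact: power_unitary.
by rewrite -/(conjm _ _) -power_conjm; apply: Pa.
Qed.

Lemma rho_density g : density (rho_ g).
Proof. by apply: density_conj rho_state; case: U_rep. Qed.

Definition rho_prob (g : G) := ic_prob (rho_ g).

Local Notation est := (guess rho_prob 1%g).

(* Undo the guessed group element on the input and reapply it on the output. *)
Definition correct n k
    (E : op R (joint (copies n A)) -> op R (joint (copies k B)))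
    c (X : op R (joint (copies n A))) : op R (joint (copies k B)) :=
  act' k (est c) (E (act n (est c)^-1%g X)).

Lemma locc_correct n k E c : locc E -> locc (@correct n k E c).
Proof.
move=> E_locc.
apply: (locc_comp (locc_comp (locc_power n k0 (U_local _)) E_locc)).
exact: locc_power.
Qed.

Hypothesis Sym_sub : Sym U rho \subset Sym U' sigma.

(** The form in which the inclusion of symmetry groups is used: [h^-1 * g] fixes [rho], hence
    [sigma]. So identifying the state suffices, even where the group element stays ambiguous. *)
Lemma same_rho_sigma g h : rho_ g = rho_ h -> sigma_ g = sigma_ h.
Proof.
move=> gh; have : (h^-1 * g)%g \in Sym U rho.
  rewrite mem_Sym -(rep_conjmM _ _ _ U_rep) gh (rep_conjmM _ _ _ U_rep).
  by rewrite mulVg rep_conjm1.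
move/(fintype.subsetP Sym_sub); rewrite mem_Sym => /eqP hg.
by rewrite -{2}hg (rep_conjmM _ _ _ U'_rep) mulKVg.
Qed.

Lemma guess_rho c h : likely rho_prob c h -> rho_ (est c) = rho_ h.
Proof.
move=> ch; have [g0 _] := rho_density (est c); have [h0 _] := rho_density h.
by apply: (ic_prob_inj g0 h0) => x; apply: (guessP 1%g x ch).
Qed.

(** If [h] is likely, the guess is right up to a symmetry and unitary invariance leaves the error of
    [E]. Otherwise the distance of two states, at most 2, is paid by the potential, which is then at
    least [(size c) ^ 2 / (4 * inv_gap)]; this yields [8 = 2 * 4]. *)
Lemma correct_error n k E c h : locc E -> (0 < size c)%N ->
  trnorm (@correct n k E c (power n (rho_ h)) - power k (sigma_ h)) <=
  trnorm (E (power n rho) - power k sigma) +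
  8 * inv_gap rho_prob / (size c)%:R ^+ 2 * potential (rho_prob h) c.
Proof.
move=> E_locc c0; have c_gt0 : 0 < (size c)%:R ^+ 2 :> R.
  by rewrite exprn_gt0 // ltr0n.
have pot0 := potential_ge0 (rho_prob h) c.
have S0 := inv_gap_ge0 rho_prob.
have [ch|] := boolP (likely rho_prob c h).
  have gh := guess_rho ch.
  rewrite -(same_rho_sigma gh) -gh /correct !power_conjm.
  rewrite (rep_conjmM _ _ _ (power_rep n U_local U_rep)) mulVg.
  rewrite (rep_conjm1 _ (power_rep n U_local U_rep)).
  rewrite /conjm -mulmxBl -mulmxBr.
  apply: le_trans (trnorm_unitary _ _) _; first exact: power_unitary.
  by rewrite lerDl mulr_ge0 // divr_ge0 ?mulr_ge0 // ltW.
rewrite -leNgt => ch.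
have d1 : trnorm (correct E c (power n (rho_ h))) <= 1.
  apply: density_trnorm; apply: (density_locc (locc_correct c E_locc)).
  by apply: density_power; apply: rho_density.
have d2 : trnorm (power k (sigma_ h)) <= 1.
  apply: density_trnorm; apply: density_power.
  by apply: density_conj sigma_state; case: U'_rep.
apply: le_trans (trnormB _ _) _; apply: le_trans (lerD d1 d2) _.
apply: ler_wpDl; first exact: trnorm_ge0.
have -> : 8 * inv_gap rho_prob / (size c)%:R ^+ 2 * potential (rho_prob h) c =
    2 * (4 * inv_gap rho_prob * potential (rho_prob h) c) / (size c)%:R ^+ 2.
  by ring.
rewrite ler_pdivlMr //; have -> : 1 + 1 = 2 :> R by [].
by rewrite ler_pM2l // ltr0n.
Qed.

Lemma cov_LOCC_of_LOCC s n k
    (E : op R (joint (copies n A)) -> op R (joint (copies k B))) : locc E ->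
  exists E' : op R (joint (copies (s + n) A)) -> op R (joint (copies k B)),
    cov_LOCC U U' E' /\
    ((0 < s)%N -> trnorm (E' (power (s + n) rho) - power k sigma) <=
      trnorm (E (power n rho) - power k sigma) + 8 * inv_gap rho_prob / s%:R).
Proof.
move=> E_locc; have A_inh := density_inhabited rho_state.
exists (twirl (protocol (correct E) (s := s) [::])).
have C_locc c : locc (correct E c) by apply: locc_correct.
split.
  by apply: twirl_cov_LOCC; apply: (locc_protocol k0 A_inh s [::] C_locc).
move=> s0; apply: twirl_error => h.
have s_neq0 : s%:R != 0 :> R by rewrite pnatr_eq0 -lt0n.
have b0 : 0 <= 8 * inv_gap rho_prob / s%:R ^+ 2.
  by apply: divr_ge0; rewrite ?sqr_ge0 // mulr_ge0 // inv_gap_ge0.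
have leaf c : size c = s -> trnorm (correct E c (power n (rho_ h)) -
    power k (sigma_ h)) <= trnorm (E (power n rho) - power k sigma) +
    8 * inv_gap rho_prob / s%:R ^+ 2 * potential (rho_prob h) c.
  by move=> cs; rewrite -cs; apply: correct_error => //; rewrite cs.
have sz : (size ([::] : seq (joint (@ic_index m A))) + s = s)%N by [].
(* The mean potential after [s] outcomes is at most [s], which turns [s ^ 2] in the denominator into
   [s]. *)
apply: le_trans (protocol_error k0 A_inh (rho_density h) C_locc b0 leaf sz) _.
rewrite potential_nil add0r le_eqVlt; apply/orP; left; apply/eqP.
by congr (_ + _); field.
Qed.

End Covariant.

(** * Rates *)

Section ZeroCopies.
Variables (R : realType) (m : nat) (B : 'I_m -> finType).
Local Notation C := (complex R).

Lemma ffun_ord0 (Q : finType) (x y : {ffun 'I_0 -> Q}) : x = y.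
Proof. by apply/ffunP => -[]. Qed.

Lemma copies0_eq (x y : joint (copies 0 B)) : x = y.
Proof. by apply/ffunP => i; apply: ffun_ord0. Qed.

(** The space of zero copies is one-dimensional, so the trace determines an operator. *)
Lemma copies0_op_eq (b : joint B) (X Y : op R (joint (copies 0 B))) :
  \tr X = \tr Y -> X = Y.
Proof.
pose z : joint (copies 0 B) := [ffun i => [ffun => b i]].
rewrite !mxtrace_ent !(big_pred1 z) => [XY||]; first last.
- by move=> x; rewrite /= (copies0_eq x z) eqxx.
- by move=> x; rewrite /= (copies0_eq x z) eqxx.
by apply: ent_inj => x y; rewrite (copies0_eq x z) (copies0_eq y z).
Qed.

Lemma locc_trace (S : 'I_m -> finType) (k0 : 'I_m) (b : joint B) :
  exists L : op R (joint S) -> op R (joint (copies 0 B)), locc L.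
Proof.
pose K i (x : S i) : 'M[C]_(#|(copies 0 B i : finType)|, #|S i|) :=
  mkrect (fun _ y => (y == x)%:R).
exists (tensor_map (fun i => kraus (K i))); apply: (locc_local k0) => i.
  exact: kraus_cp.
move=> X; rewrite kraus_trace; have -> : \sum_x (K i x)^t* *m K i x = 1%:M.
  apply: ent_inj => y z; rewrite ent_sum ent1.
  pose t : copies 0 B i := [ffun => b i].
  transitivity (\sum_(x : S i) (x == y)%:R * (z == x)%:R : C).
    apply: eq_bigr => x _; rewrite ent_mul (big_pred1 t) => [|u]; last first.
      by rewrite /= (ffun_ord0 u t) eqxx.
    by rewrite ent_adj !ent_mkrect rmorph_nat eq_sym.
  by rewrite (sum_delta (fun x => (z == x)%:R)) eq_sym.
by rewrite mul1mx.
Qed.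

End ZeroCopies.

Lemma lt_double_eighth (F : realFieldType) (d v : F) :
  0 < d -> 2^-1 * v <= d / 8 -> v + v < d.
Proof. by lra. Qed.

Section Rates.
Variables (R : realType) (m : nat) (A B : 'I_m -> finType) (G : finGroupType).
Local Notation C := (complex R).
Variables (U : G -> op R (joint A)) (U' : G -> op R (joint B)).
Hypothesis U_rep : proj_unitary_rep U.
Hypothesis U'_rep : proj_unitary_rep U'.
Hypothesis U_local : forall g, local_unitary (U g).
Hypothesis U'_local : forall g, local_unitary (U' g).
Variable k0 : 'I_m.
Variables (rho : op R (joint A)) (sigma : op R (joint B)).
Hypothesis rho_state : density rho.
Hypothesis sigma_state : density sigma.

(** With no output copies, any trace-preserving map is covariant and reaches the target exactly.
    This makes the set of achievable rates nonempty, so that its supremum is not [-oo]. *)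
Lemma cov_achievable0 : achievable (cov_LOCC U U') rho sigma 0.
Proof.
have [b] := density_inhabited sigma_state.
(* The number of output copies at rate 0 equals 0 only propositionally, hence the statement for a
   general [k]. *)
have E0 n k : k = 0%N ->
    exists E : op R (joint (copies n A)) -> op R (joint (copies k B)),
      cov_LOCC U U' E /\ trdist (E (power n rho)) (power k sigma) = 0.
  move=> ->; have [E E_locc] := locc_trace R (copies n A) k0 b.
  have [_ _ E_tr] := locc_channel E_locc.
  exists E; split; first split=> // g X; last first.
    suff -> : E (power n rho) = power 0 sigma.
      by rewrite /trdist subrr trnorm0 mulr0.
    apply: (copies0_op_eq b); rewrite E_tr.
    by have [_ ->] := density_power n rho_state;
      have [_ ->] := density_power 0 sigma_state.
  rewrite -/(conjm _ _) -/(conjm _ (E X)).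
  apply: (copies0_op_eq b); rewrite E_tr !conjm_trace.
  by rewrite !unitarymxPl ?mul1mx ?E_tr //; apply: power_unitary.
rewrite /achievable /=; have k_0 n : Num.truncn (0 * n%:R : R) = 0%N.
  by rewrite mul0r truncn0.
exists (fun n => projT1 (cid (E0 n _ (k_0 n)))); split=> [n|].
  by case: cid => E [].
rewrite (_ : (fun n => _) = (fun=> 0)); first exact: cvg_cst.
by apply/funext => n; case: cid => E [].
Qed.

Lemma discard_to (X : op R (joint B)) k K : density X -> (k <= K)%N ->
  exists D : op R (joint (copies K B)) -> op R (joint (copies k B)),
    locc D /\ forall X, density X -> D (power K X) = power k X.
Proof.
move=> X_state kK; have B_inh := density_inhabited X_state.
by rewrite -(subnK kK); apply: (locc_discard R k0 B_inh).
Qed.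

Lemma locc_trnormB (S T : 'I_m -> finType)
    (L : op R (joint S) -> op R (joint T)) X Y :
  locc L -> density X -> density Y ->
  trnorm (L X - L Y) <= trnorm (X - Y).
Proof.
move=> L_locc [X0 _] [Y0 _]; have [L_lin _ _] := locc_channel L_locc.
rewrite -linearB_of //; apply: locc_trnorm => //.
by rewrite adjmxB (psd_herm X0) (psd_herm Y0).
Qed.

Lemma cov_achievable (r q : R) : Sym U rho \subset Sym U' sigma ->
  0 < q -> q < r -> achievable (@LOCC R m A B) rho sigma r ->
  achievable (cov_LOCC U U') rho sigma q.
Proof.
move=> Sym_sub q0 qr [E [E_locc E_cvg]]; have r0 : 0 < r := lt_trans q0 qr.
pose t := q / r; have t0 : 0 < t by rewrite divr_gt0.
have t1 : t < 1 by rewrite ltr_pdivrMr // mul1r.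
(* Rounding [t * n] up ensures [r * used n >= q * n], that is, enough output copies. When the
   minimum is [n], this holds by [q < r], and no error bound is claimed as no copy is left to
   measure. *)
pose used n := minn n (Num.truncn (t * n%:R)).+1.
pose c := 8 * inv_gap (rho_prob U rho).
pose u n := trnorm (E n (power n rho) - power (Num.truncn (r * n%:R)) sigma).
have used_le n : (used n <= n)%N by apply: geq_minl.
have key n : exists E' : op R (joint (copies n A)) ->
    op R (joint (copies (Num.truncn (q * n%:R)) B)),
    cov_LOCC U U' E' /\ ((used n < n)%N ->
      trnorm (E' (power n rho) - power (Num.truncn (q * n%:R)) sigma) <=
      u (used n) + c / (n - used n)%:R).
  have [D [D_locc D_power]] : exists D : op R (joint (copies
      (Num.truncn (r * (used n)%:R)) B)) ->
      op R (joint (copies (Num.truncn (q * n%:R)) B)),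
    locc D /\ forall X, density X ->
      D (power (Num.truncn (r * (used n)%:R)) X) =
      power (Num.truncn (q * n%:R)) X.
    apply: (discard_to sigma_state); apply: le_truncn; rewrite /used /minn.
    case: ifP => _; first by rewrite ler_wpM2r // ltW.
    rewrite -ler_pdivrMl // mulrA [_^-1 * _]mulrC -/t.
    by apply/ltW/truncnS_gt.
  have DE_locc := locc_comp (E_locc (used n)) D_locc.
  have := cov_LOCC_of_LOCC U_rep U'_rep U_local U'_local k0 rho_state
    sigma_state Sym_sub (n - used n) DE_locc.
  rewrite subnK // subn_gt0 => -[E' [E'_cov E'_err]].
  exists E'; split=> // un; apply: le_trans (E'_err un) _.
  rewrite lerD2r -(D_power sigma sigma_state); apply: locc_trnormB => //.
    exact/(density_locc (E_locc _))/density_power.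
  exact: density_power.
exists (fun n => projT1 (cid (key n))); split=> [n|].
  by case: cid => E' [].
apply/cvgrPdist_le => e e0.
have e2 : 0 < e / 2 by rewrite divr_gt0.
have /cvgrPdist_le/(_ _ e2)[N _ Nu] := E_cvg.
have S0 : 0 <= c by rewrite mulr_ge0 // inv_gap_ge0.
(* The threshold from [N%:R / t] forces [used n >= N]. The last one leaves more than [c / e] copies
   to measure, where [+ 1] pays for the rounding up in [used]. Both contributions to the trace
   distance are then at most [e / 2]. *)
pose M := (maxn N (maxn (Num.truncn (N%:R / t)).+1
   (Num.truncn ((c / e + 1) / (1 - t))).+1)).
exists M => // n /= nM.
have /= nN : (N <= n)%N by apply: leq_trans nM; rewrite leq_maxl.
have nt : N%:R < t * n%:R.
  rewrite mulrC -ltr_pdivrMr //; apply: lt_le_trans (truncnS_gt _) _.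
  by rewrite ler_nat; apply: leq_trans nM; rewrite !leq_max leqnn orbT.
have ns : c / e + 1 < (1 - t) * n%:R.
  rewrite [ltRHS]mulrC -ltr_pdivrMr ?subr_gt0 //; apply: lt_le_trans (truncnS_gt _) _.
  by rewrite ler_nat; apply: leq_trans nM; rewrite !leq_max leqnn !orbT.
have tn0 : 0 <= t * n%:R by rewrite mulr_ge0 // ltW.
have ce0 : 0 <= c / e by rewrite divr_ge0 // ltW.
have trunc_lt : (Num.truncn (t * n%:R)).+1%:R < n%:R - c / e :> R.
  have /andP[tr _] := truncn_itv tn0.
  rewrite mulrSr; apply: le_lt_trans (_ : t * n%:R + 1 < _).
    by rewrite lerD2r.
  by rewrite ltrBrDr -addrA addrC -ltrBrDr addrC -[X in X - _]mul1r -mulrBl.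
have trunc_n : ((Num.truncn (t * n%:R)).+1 < n)%N.
  by rewrite -(ltr_nat R); apply: lt_le_trans trunc_lt _; rewrite gerBl.
have usedE : used n = (Num.truncn (t * n%:R)).+1.
  by rewrite /used; apply/minn_idPr/ltnW.
case: cid => E' [_ /=]; rewrite {1}usedE trunc_n => /(_ isT) E'_err.
have used_N : (N <= used n)%N.
  rewrite usedE -(ler_nat R); apply/ltW/(lt_trans nt)/truncnS_gt.
have u_le : 2^-1 * u (used n) <= e / 2.
  have := Nu _ used_N; rewrite sub0r normrN ger0_norm //.
  by rewrite /trdist mulr_ge0 ?trnorm_ge0.
have c_le : c / (n - used n)%:R <= e.
  have d0 : c / e < (n - used n)%:R.
    by rewrite natrB // usedE ltrBrDr addrC -ltrBrDr.
  rewrite ler_pdivrMr; last exact: le_lt_trans d0.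
  by rewrite mulrC -ler_pdivrMr //; apply: ltW.
rewrite sub0r normrN ger0_norm; last by rewrite /trdist mulr_ge0 ?trnorm_ge0.
rewrite /trdist; have : 2^-1 * (u (used n) + c / (n - used n)%:R) <= e.
  rewrite mulrDr [leRHS]splitr; apply: lerD => //.
  by rewrite mulrC ler_wpM2r.
by apply: le_trans; rewrite ler_wpM2l.
Qed.
Lemma power1_inj (X Y : op R (joint B)) : power 1 X = power 1 Y -> X = Y.
Proof.
move=> XY; apply: ent_inj => x y.
have := congr1 (fun Z => ent Z (untwist [ffun => x]) (untwist [ffun => y])) XY.
by rewrite !ent_mkop !big_ord1 !copy_untwist !ffunE.
Qed.

Lemma cov_achievable_Sym (r : R) : 0 < r ->
  achievable (cov_LOCC U U') rho sigma r -> Sym U rho \subset Sym U' sigma.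
Proof.
move=> r0 [E [E_cov E_cvg]]; apply/fintype.subsetP => g.
rewrite !mem_Sym => /eqP rho_g; apply: contraT => sigma_g.
pose s := conjm (U' g) sigma.
have s_state : density s by apply: density_conj sigma_state; case: U'_rep.
pose d := trnorm (power 1 s - power 1 sigma).
have d0 : 0 < d.
  rewrite lt_def trnorm_ge0 andbT; apply: contraNneq sigma_g => /trnorm_eq0 d0.
  by apply/eqP/power1_inj/eqP; rewrite -subr_eq0 d0.
(* A trace distance of at most [d / 8] is a trace norm [v] of at most [d / 4], so [v + v < d]
   contradicts the triangle inequality. *)
have e0 : 0 < d / 8 by rewrite divr_gt0.
have /cvgrPdist_le/(_ _ e0)[N _ Nu] := E_cvg.
(* [n > r^-1] guarantees at least one output copy. *)
pose n := maxn N (Num.truncn r^-1).+1.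
have := Nu n (leq_maxl _ _); rewrite sub0r normrN ger0_norm; last first.
  by rewrite /trdist mulr_ge0 ?trnorm_ge0.
have k1 : (0 < Num.truncn (r * n%:R))%N.
  rewrite truncn_gt0 mulrC -ler_pdivrMr // div1r.
  apply: ltW; apply: lt_le_trans (truncnS_gt _) _.
  by rewrite ler_nat leq_maxr.
rewrite /trdist; move: (E n) (E_cov n).
move: (Num.truncn _) k1 => k k1 F [_ F_cov].
have [D [D_locc D_power]] := discard_to sigma_state k1.
set v := trnorm (F _ - _) => v_le.
have FE : conjm (power k (U' g)) (F (power n rho)) = F (power n rho).
  by rewrite /conjm -F_cov -/(conjm _ _) -power_conjm rho_g.
have d_le : d <= trnorm (power k s - power k sigma).
  rewrite /d -(D_power s s_state) -(D_power sigma sigma_state).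
  by apply: locc_trnormB => //; apply: density_power.
have v1 : trnorm (power k s - F (power n rho)) <= v.
  rewrite -FE /s power_conjm {1 2}/conjm -mulmxBl -mulmxBr /v trnormC.
  apply: le_trans (trnorm_unitary _ _) _; first exact: power_unitary.
  exact: lexx.
have : trnorm (power k s - power k sigma) <= v + v.
  rewrite -[power k s](subrK (F (power n rho))) -addrA.
  exact: (le_trans (trnormD _ _) (lerD v1 (lexx v))).
by move/(le_trans d_le); rewrite leNgt (lt_double_eighth d0 v_le).
Qed.

End Rates.

Theorem theorem6 (R : realType) (m : nat) (m_gt0 : (0 < m)%N)
    (A B : 'I_m -> finType) (G : finGroupType)
    (U : G -> op R (joint A)) (U' : G -> op R (joint B))
    (U_rep : proj_unitary_rep U) (U'_rep : proj_unitary_rep U')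
    (U_local : forall g, local_unitary (U g))
    (U'_local : forall g, local_unitary (U' g))
    (rho : op R (joint A)) (sigma : op R (joint B))
    (rho_state : density rho) (sigma_state : density sigma) :
  rate (cov_LOCC U U') rho sigma =
  if Sym U rho \subset Sym U' sigma then rate (@LOCC R m A B) rho sigma
  else 0%E.
Proof.
pose k0 := Ordinal m_gt0.
have cov0 := cov_achievable0 U_local U'_local k0 rho_state sigma_state.
case: ifP => Sym_sub; last first.
  rewrite /rate -[RHS](@ereal_sup1 R); congr ereal_sup.
  apply/seteqP; split=> [_ [r [r0 r_ach] <-]|_ ->]; last by exists 0.
  rewrite /=; congr (_%:E); apply/eqP; rewrite eq_le r0 andbT leNgt.
  apply: contraFN Sym_sub => r_gt0.
  exact: (cov_achievable_Sym U'_rep U'_local k0 sigma_state r_gt0 r_ach).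
apply/eqP; rewrite eq_le; apply/andP; split.
  apply: ereal_sup_le => _ [r [r0 [E [E_cov E_cvg]]] <-]; exists r => //.
  by split=> //; exists E; split=> // n; case: (E_cov n).
(* This excludes the value [-oo] and makes the midpoint below positive, as [cov_achievable]
   requires. *)
have sup0 : (0%:E <= rate (cov_LOCC U U') rho sigma)%E.
  by apply: ereal_sup_ubound; exists 0.
apply: ge_ereal_sup => _ [r [r0 r_ach] <-].
rewrite leNgt; apply/negP => sup_lt; move: sup0 sup_lt.
case E: (rate _ _ _) => [x||] //; rewrite lee_fin lte_fin => x0 xr.
(* The copies spent on estimation cost some rate, so [r] itself is out of reach; the midpoint lies
   below [r] and still exceeds the supposed supremum [x]. *)
have xq : x < (x + r) / 2 by rewrite midf_lt.
have qr : (x + r) / 2 < r by rewrite midf_lt.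
have q0 := le_lt_trans x0 xq.
have q_ach := cov_achievable U_rep U'_rep U_local U'_local k0 rho_state
  sigma_state Sym_sub q0 qr r_ach.
have : (((x + r) / 2)%:E <= rate (cov_LOCC U U') rho sigma)%E.
  by apply: ereal_sup_ubound; exists ((x + r) / 2) => //; split=> //; apply: ltW.
by rewrite E lee_fin leNgt xq.
Qed.
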